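(* Let $X=(X_t)_{t\ge 0}$ be either a standard Brownian motion or, more generally, a recurrent diffusion process on $\mathbb R$, started at $X_0=0$ under a probability measure $\mathsf P$, and let $\mu$ be a probability measure on $(\mathbb R,\mathcal B(\mathbb R))$ such that $\mu(\{0\})=0$. Then the functions embedding $\mu$ into $X$ are uniquely determined by $\mu$, that is: (I) If $\operatorname{supp}(\mu)\subseteq\mathbb R_+$ and $b_1,b_2:(0,\infty)\to\mathbb R$ are left-continuous increasing functions such that $X_{\tau_{b_1}}\sim\mu$ and $X_{\tau_{b_2}}\sim\mu$, where $\tau_{b_i}=\inf\{t>0 : X_t\ge b_i(t)\}$ for $i=1,2$, then $b_1=b_2$. (II) If $\operatorname{supp}(\mu)\subseteq\mathbb R_-$ and $c_1,c_2:(0,\infty)\to\mathbb R$ are left-continuous decreasing functions such that $X_{\tau_{c_1}}\sim\mu$ and $X_{\tau_{c_2}}\sim\mu$, where $\tau_{c_i}=\inf\{t>0 : X_t\le c_i(t)\}$ for $i=1,2$, then $c_1=c_2$. (III) If $\operatorname{supp}(\mu)\cap\mathbb R_+\ne\varnothing$ and $\operatorname{supp}(\mu)\cap\mathbb R_-\ne\varnothing$, and if $b_1,b_2:(0,\infty)\to\mathbb R\cup\{+\infty\}$ are left-continuous increasing functions and $c_1,c_2:(0,\infty)\to\mathbb R\cup\{-\infty\}$ are left-continuous decreasing functions such that $X_{\tau_{b_1,c_1}}\sim\mu$ and $X_{\tau_{b_2,c_2}}\sim\mu$, where $\tau_{b_i,c_i}=\inf\{t>0 : X_t\ge b_i(t)\text{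 or }X_t\le c_i(t)\}$ for $i=1,2$, then $b_1=b_2$ and $c_1=c_2$.
   Context: $\mathbb R_+=[0,\infty)$ and $\mathbb R_-=(-\infty,0]$. $\operatorname{supp}(\mu)$ is the (closed) topological support of $\mu$. ''Increasing'' and ''decreasing'' are meant in the weak sense (non-decreasing, non-increasing). For a random time $\tau$, $X_\tau\sim\mu$ means that $\tau<\infty$ almost surely and the law of $X_\tau$ is $\mu$. A diffusion process on $\mathbb R$ is understood in the sense of Itô and McKean: a time-homogeneous strong Markov process with state space $\mathbb R$ and continuous sample paths; $\mathsf P_x$ denotes the law under which it starts at $x$ (so $\mathsf P=\mathsf P_0$). It is recurrent if $\mathsf P_x(\tau_y<\infty)=1$ for all $x,y\in\mathbb R$, where $\tau_y=\inf\{t>0 : X_t=y\}$; recurrent diffusions are in particular regular. *)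

(* Defs.v *)
From HB Require Import structures.
From mathcomp Require Import all_boot all_order all_algebra.
From mathcomp Require Import all_classical all_reals all_analysis.
From mathcomp Require Import measurable_realfun.
Set Implicit Arguments.
Unset Strict Implicit.
Unset Printing Implicit Defensive.
Import Order.TTheory GRing.Theory Num.Theory.
Import numFieldNormedType.Exports.
Local Open Scope classical_set_scope.
Local Open Scope ring_scope.

(* A process is a function X : R -> T -> R (time, then sample point); only its
   values at times t >= 0 are ever constrained or used. *)

Definition topological_support (R : realType)
    (mu : probability (measurableTypeR R) R) : set R :=
  [set x | forall U : set R, open U -> U x -> (0 < mu U)%E].

Definition past (R : realType) d (T : measurableType d) (X : R -> T -> R)
    (t : R) : set (set T) :=
  <<s \bigcup_(s in `[0, t]%classic)
        preimage_set_system setT (X s : T -> measurableTypeR R) measurable >>.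

(* Cylinder sigma-algebra of the path space, generated by the coordinate maps
   at times s >= 0. *)
Definition path_event (R : realType) : set (set (R -> R)) :=
  <<s \bigcup_(s in `[0, +oo[%classic)
        preimage_set_system setT
          ((fun p : R -> R => p s) : (R -> R) -> measurableTypeR R) measurable >>.

(* Time of first entry, at strictly positive times, of the space-time process
   (t, X_t) into the graph of D; it is +oo if there is no entry. *)
Definition entry_time (R : realType) (T : Type) (X : R -> T -> R)
    (D : R -> set R) (w : T) : \bar R :=
  ereal_inf [set t%:E | t in [set t : R | 0 < t /\ D t (X t w)]].

(* Optional times of the natural filtration (events {tau < t}, t > 0). *)
Definition markov_time (R : realType) d (T : measurableType d)
    (X : R -> T -> R) (tau : T -> \bar R) : Prop :=
  (forall w, (0 <= tau w)%E) /\
  (forall t : R, 0 < t -> past X t [set w | (tau w < t%:E)%E]).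

Definition past_plus (R : realType) d (T : measurableType d)
    (X : R -> T -> R) (tau : T -> \bar R) : set (set T) :=
  [set A | forall t : R, 0 < t ->
             past X t (A `&` [set w | (tau w < t%:E)%E])].

(* Given F_{tau+} and on {tau < +oo}, the path after tau has the law of X
   under P_y, where y = X_tau. *)
Definition strong_markov (R : realType) d (T : measurableType d)
    (P : R -> probability T R) (X : R -> T -> R) : Prop :=
  forall (x : R) (tau : T -> \bar R) (A : set T) (B : set (R -> R)),
    markov_time X tau -> past_plus X tau A -> @path_event R B ->
    P x (A `&` [set w | (tau w < +oo)%E] `&`
         [set w | B (fun s => X (fine (tau w) + s) w)]) =
    (\int[P x]_(w in A `&` [set w | (tau w < +oo)%E])
       P (X (fine (tau w)) w) [set w' | B (fun s => X s w')])%E.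

(* Diffusion on R in the sense of Ito and McKean; P x is the law under which
   the process starts at x. For P x the law of x + W, W a standard Brownian
   motion, on the space of continuous paths, this is Brownian motion. *)
Record diffusion (R : realType) d (T : measurableType d)
    (P : R -> probability T R) (X : R -> T -> R) : Prop := {
  diffusion_measurable : forall t : R, 0 <= t ->
    measurable_fun setT (X t : T -> measurableTypeR R) ;
  diffusion_continuous : forall w : T,
    {within `[0, +oo[%classic, continuous (fun t => X t w)} ;
  diffusion_start : forall x : R, P x [set w | X 0 w = x] = 1%E ;
  diffusion_measurable_law : forall B : set (R -> R), @path_event R B ->
    measurable_fun setT ((fun x : R => P x [set w | B (fun s => X s w)])
                         : measurableTypeR R -> \bar R) ;
  diffusion_strong_markov : strong_markov P X }.

Definition recurrent (R : realType) d (T : measurableType d)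
    (P : R -> probability T R) (X : R -> T -> R) : Prop :=
  forall x y : R,
    P x [set w | (entry_time X (fun=> [set y]) w < +oo)%E] = 1%E.

(* X_tau ~ mu; the value X (fine +oo) taken where tau = +oo is immaterial since
   that happens with probability 0. *)
Definition embeds (R : realType) d (T : measurableType d)
    (P : probability T R) (X : R -> T -> R) (tau : T -> \bar R)
    (mu : probability (measurableTypeR R) R) : Prop :=
  {ae P, forall w, (tau w < +oo)%E} /\
  (forall B : set (measurableTypeR R), measurable B ->
     pushforward P
       ((fun w => X (fine (tau w)) w) : T -> measurableTypeR R) B = mu B).

Definition left_continuous (R : realType) (V : topologicalType)
    (f : R -> V) : Prop :=
  forall t : R, 0 < t -> f s @[s --> t^'-] --> f t.

Definition upper_time (R : realType) (T : Type) (X : R -> T -> R)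
    (b : R -> R) : T -> \bar R :=
  entry_time X (fun t => [set x | b t <= x]).

Definition lower_time (R : realType) (T : Type) (X : R -> T -> R)
    (c : R -> R) : T -> \bar R :=
  entry_time X (fun t => [set x | x <= c t]).

Definition two_sided_time (R : realType) (T : Type) (X : R -> T -> R)
    (b c : R -> \bar R) : T -> \bar R :=
  entry_time X (fun t => [set x | (b t <= x%:E)%E \/ (x%:E <= c t)%E]).

(* Boundaries: functions on (0, +oo), whose values at t <= 0 are never used. *)
Definition increasing_boundary (R : realType) (b : R -> R) : Prop :=
  {in `]0, +oo[ &, nondecreasing_fun b} /\ left_continuous b.

Definition decreasing_boundary (R : realType) (c : R -> R) : Prop :=
  {in `]0, +oo[ &, nonincreasing_fun c} /\ left_continuous c.

Definition increasing_eboundary (R : realType) (b : R -> \bar R) : Prop :=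
  [/\ (forall t : R, 0 < t -> b t <> -oo%E),
      {in `]0, +oo[ &, nondecreasing_fun b} & left_continuous b].

Definition decreasing_eboundary (R : realType) (c : R -> \bar R) : Prop :=
  [/\ (forall t : R, 0 < t -> c t <> +oo%E),
      {in `]0, +oo[ &, nonincreasing_fun c} & left_continuous c].

(* Main.v *)
Require Import Defs.
From HB Require Import structures.
From mathcomp Require Import all_boot all_order all_algebra.
From mathcomp Require Import all_classical all_reals all_analysis.
From mathcomp Require Import measurable_realfun.
From mathcomp Require Import lra.
Set Implicit Arguments.
Unset Strict Implicit.
Unset Printing Implicit Defensive.
Import Order.TTheory GRing.Theory Num.Theory.
Import numFieldNormedType.Exports.
Local Open Scope classical_set_scope.
Local Open Scope ring_scope.

(** Write [D_t] for the set of the levels [x] with [b t <= x] or [x <= c t].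
    Monotonicity and left-continuity of [b] and [c] make [(D_t)] a
    family of closed sets that decreases in [t] and is left-continuous, while the
    gap [~` D_t] is an interval. One-sided boundaries are the cases [c = -oo]
    and [b = +oo], so that the three parts are one uniqueness statement about
    such barriers, [barrier_unique]. Its proof has two halves.

    Two barriers [D1] and [D2] that embed the same law are entered at the same
    time, almost surely ([pr_earlier0]). Let tau be the smaller of the entry
    times tau1 and tau2. The times at which a level belongs to [D1] form an
    initial interval of the time axis, and so do those for [D2]; these two
    intervals are comparable. Hence, as observed by Loynes, [X_tau] is [X_tau1]
    over the levels where the first interval is the longer one and [X_tau2]
    over the other levels, and the law of [X_tau] is at most mu ([atmin_le]).
    Now let [K] be the gap of [D1] at time [t]. If [X_tau1] is in [K], then
    tau1 < [t] because [D1] decreases, and it follows that [X_tau] is in [K].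
    The second of these nested events has probability at most mu([K]), which is
    the probability of the first, so that they agree almost surely, for all
    rational [t] at once. But if tau2 < tau1, then [X_tau2] is in the gap of
    [D1] at time tau2, hence already at some rational [t] < tau2; then [X_tau1]
    is in that gap as well, which means tau1 < [t] < tau2. This is absurd.

    Equal entry times force equal barriers ([barrier_sub]). Suppose that a
    level [x] belongs to [D2] but not to [D1] at time [t]. By left-continuity
    it is still in the gap of [D1] at some [r < t]. With positive probability
    the path avoids both barriers up to time [r] ([pr_survive]) and then
    visits [x] before time [t] without leaving this gap
    ([pr_hits_first_gt0]). Such a path enters [D2] before [D1].

    This uses two properties of a recurrent diffusion: it can remain for any
    length of time in a neighbourhood of its starting point ([pr_stay_gt0]),
    and it can reach any other level in an arbitrarily short time
    ([pr_hit_gt0]). Both rest on the fact that it can leave an interval at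
    either end ([pr_before_gt0]). The second one is the deepest step: there is
    no speed limit. Suppose that the passage from [y] to [v] takes at least eta
    almost surely. Cut the way from [y] to [v] into [n] steps of equal scale,
    and let [l_k] be the least time that the [k]-th step can take, so that the
    sum of the [l_k] is at least eta. Choose a level [V] beyond [v] and let
    [F x] be the expected length of the part of a long time interval [0, T]
    that follows the first visit to [V], for the process started at [x]. From a
    grid point both neighbours are equally likely to be visited first, and the
    step forward costs at least [l_k]; therefore each increment of [F] along
    the grid exceeds the previous one by a multiple of [l_k], and the last one
    is at least a multiple of eta. But [F] is bounded and the convexity of the
    increments continues beyond [v], so that the last increment is of order
    [1/n]. This is a contradiction when [n] is large ([grid_bound]). *)

(** * Arithmetic of convex increments *)

Section arithmetic.
Variable R : realFieldType.
Implicit Types p s e q d r u : R.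

(** The weight with which a symmetric step goes up is at most one half as soon
    as the mean over the step does not exceed the middle value. *)
Lemma weight_le_half p s e q : 0 < e ->
  p * (s + (q + 1 + 1) * e) + (1 - p) * (s + q * e) <= s + (q + 1) * e ->
  p <= 1 - p.
Proof. by move=> e0 H; nra. Qed.

Lemma overshoot_weight p r s u e :
  p * r + (1 - p) * (u + (s - u - e)) <= s -> p * (r - s) <= (1 - p) * e.
Proof. by lra. Qed.

(** An increment [d] followed by a rise of at most [j] over a scale distance
    [s] is a small fraction [e / s] of that rise. *)
Lemma last_increment_bound p e d h j s : 0 < p -> p < 1 -> 0 <= e -> 0 <= s ->
  0 <= h -> h <= j -> (1 - p) * d <= p * h -> p * s <= (1 - p) * e ->
  d * s <= e * j.
Proof.
move=> p0 p1 e0 s0 h0 hj H Hs.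
have q0 : 0 < 1 - p by lra.
rewrite -(ler_pM2l q0).
apply: (@le_trans _ _ (p * h * s)).
  by rewrite mulrA; apply: ler_wpM2r.
apply: (@le_trans _ _ ((1 - p) * e * h)).
  by rewrite mulrAC; apply: ler_wpM2r.
by rewrite -mulrA; apply: ler_wpM2l; [lra|exact: ler_wpM2l].
Qed.

Lemma slow_sum_bound S d s e j q c T : 0 < q -> 0 < s -> e * q <= 1 -> 0 <= T ->
  0 < c -> j * c = 2 * T -> d * s <= e * j -> S * 2^-1 <= d ->
  S * c * s * q <= 4 * T.
Proof.
move=> q0 s0 eq1 T0 c0 jc dse Sd.
have h : S * 2^-1 * s <= e * j by apply: le_trans dse; apply: ler_wpM2r => //; exact: ltW.
have /(ler_wpM2r (ltW c0)) : S * 2^-1 * s * q <= j.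
  apply: le_trans (ler_wpM2r (ltW q0) h) _.
  have j0 : 0 <= j by rewrite -(pmulr_lge0 _ c0) jc mulr_ge0.
  by rewrite mulrAC; apply: ler_piMl.
by rewrite jc; lra.
Qed.

End arithmetic.

(** * Events of the path observed during a set of times *)
Section observables.
Context {R : realType}.
Implicit Types (p : R -> R) (I : set R) (B : set (R -> R)).

Definition contpath p := {within `[0, +oo[%classic, continuous p}.

Definition coord_sigma I : set (set (R -> R)) :=
  <<s \bigcup_(s in I) preimage_set_system setT
        ((fun p : R -> R => p s) : (R -> R) -> measurableTypeR R) measurable >>.

(** Sets of arbitrary paths given by uncountably many times are not in the
    sigma-algebra of the coordinates. Only their trace on the continuous paths
    matters. *)
Definition observable I B :=
  exists2 B', coord_sigma I B' & forall p, contpath p -> B p <-> B' p.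

Lemma coord_sigma_algebra I : sigma_algebra setT (coord_sigma I).
Proof. exact: smallest_sigma_algebra. Qed.

(** Measurability of an event of the path only has to be checked on the
    coordinates. The process [Y] will be the diffusion itself, or the
    diffusion restarted at a random time. *)
Lemma coord_sigma_transfer (U : Type) (Y : R -> U -> R) (G : set (set U)) I :
  sigma_algebra setT G ->
  (forall s (M : set (measurableTypeR R)), I s -> measurable M ->
     G [set w | M (Y s w)]) ->
  forall B, coord_sigma I B -> G [set w | B (fun s => Y s w)].
Proof.
move=> [G0 GC GU] GI; apply: smallest_sub.
  split => [|A|A] /=; first exact: G0.
  - move=> /GC; congr G; apply/seteqP; split => w /=; tauto.
  - by move=> /GU; congr G; apply/seteqP; split => w.
by move=> A [s Is [M mM <-]] /=; have := GI s M Is mM; congr G; apply/seteqP; split => w /=; tauto.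
Qed.

Lemma observableC I B : observable I B -> observable I (~` B).
Proof.
move=> [B' sB' BB']; exists (~` B').
  by rewrite -setTD; have [_ + _] := coord_sigma_algebra I; exact.
by move=> p /BB' H /=; tauto.
Qed.

Lemma observable_bigcup I (B : nat -> set (R -> R)) :
  (forall n, observable I (B n)) -> observable I (\bigcup_n B n).
Proof.
move=> oB; have /choice[B' B'P] : forall n, exists B', coord_sigma I B' /\
    forall p, contpath p -> B n p <-> B' p.
  by move=> n; have [B' ? ?] := oB n; exists B'.
exists (\bigcup_n B' n).
  have [_ _ +] := coord_sigma_algebra I; apply => n; exact: (B'P n).1.
by move=> p cp; split => -[n _ Hn]; exists n => //; apply/(B'P n).2.
Qed.

Lemma observable_ext I B B' : observable I B ->
  (forall p, contpath p -> B p <-> B' p) -> observable I B'.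
Proof.
by move=> [C sC BC] BB'; exists C => // p cp; rewrite -BC// BB'.
Qed.

Lemma observable0 I : observable I set0.
Proof. by exists set0 => //; have [] := coord_sigma_algebra I. Qed.

Lemma observableT I : observable I setT.
Proof. by rewrite -setC0; apply: observableC; exact: observable0. Qed.

Lemma observable_prop I (Q : Prop) : observable I (fun=> Q).
Proof.
have [q|q] := pselect Q.
  by apply: observable_ext (observableT I) _ => p _; split.
by apply: observable_ext (observable0 I) _ => p _; split.
Qed.

Lemma observableU I A B :
  observable I A -> observable I B -> observable I (A `|` B).
Proof.
move=> oA oB; rewrite -bigcup2E; apply: observable_bigcup => -[|[|n]] //=.
exact: observable0.
Qed.

Lemma observableI I A B :
  observable I A -> observable I B -> observable I (A `&` B).
Proof.
move=> oA oB; rewrite -(setCK (A `&` B)) setCI.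
by apply/observableC/observableU; exact: observableC.
Qed.

Lemma observable_bigcap I (B : nat -> set (R -> R)) :
  (forall n, observable I (B n)) -> observable I (\bigcap_n B n).
Proof.
move=> oB; rewrite -(setCK (\bigcap_n _)) setC_bigcap.
by apply/observableC/observable_bigcup => n; exact: observableC.
Qed.

Lemma observable_exists_rat I (B : rat -> set (R -> R)) :
  (forall q, observable I (B q)) -> observable I [set p | exists q, B q p].
Proof.
move=> oB.
pose C n := if unpickle n is Some q then B q else set0.
apply: (@observable_ext _ (\bigcup_n C n)).
  apply: observable_bigcup => n; rewrite /C.
  by case: unpickle => //; exact: observable0.
move=> p _; split => [[n _]|[q Bq]].
  by rewrite /C; case: unpickle => // q Bq; exists q.
by exists (pickle q); [exact: Logic.I|rewrite /C pickleK].
Qed.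

Lemma observable_coord I s (M : set (measurableTypeR R)) : I s ->
  measurable M ->
  observable I [set p | M (p s)].
Proof.
move=> Is mM; exists [set p | M (p s)] => //.
apply: sub_gen_smallest; exists s => //; exists M => //.
by rewrite setTI.
Qed.

Lemma observableS I J B : I `<=` J -> observable I B -> observable J B.
Proof.
move=> IJ [B' sB' BB']; exists B' => //.
apply: (coord_sigma_transfer (Y := fun s p => p s) (coord_sigma_algebra J) _ sB').
move=> s M Is mM; apply: sub_gen_smallest; exists s; first exact: IJ.
by exists M => //; rewrite setTI.
Qed.

End observables.

(** * Entry of a continuous path into a barrier *)
Section hitting.
Context {R : realType}.
Implicit Types (p : R -> R) (D : R -> set R) (s t x y z : R).

Lemma contpath_eps p s (e : R) : contpath p -> 0 <= s -> 0 < e ->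
  exists2 d : R, 0 < d & forall u : R, 0 <= u -> `|u - s| < d -> `|p u - p s| < e.
Proof.
move=> /subspace_continuousP cp s0 e0.
have /cp : `[0, +oo[%classic s by rewrite /= in_itv/= s0.
move=> /cvgrPdist_lt/(_ _ e0); rewrite near_withinE => -[d /= d0 dP].
exists d => // u u0 us; rewrite distrC; apply: dP; rewrite /= ?in_itv/= ?u0//.
by rewrite distrC.
Qed.

Lemma small_invS (e : R) : 0 < e -> exists n : nat, n.+1%:R^-1 < e.
Proof.
move=> e0; have [n _ /(_ n (leqnn _))] := near_infty_natSinv_lt (PosNum e0).
by exists n.
Qed.

Lemma contpath_segment p a b : contpath p -> 0 <= a ->
  {within `[a, b], continuous p}.
Proof.
move=> cp a0; apply: continuous_subspaceW cp => x /=.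
by rewrite !in_itv/= andbT => /andP[ax _]; exact: le_trans ax.
Qed.

(** These are Rost's reversed barriers: the times at which a level belongs to
    the barrier form an initial interval that contains its right end point.
    A constant closed set is a barrier, so that first visits to a point and
    exits from an open set are entries as well. *)
Record barrier D : Prop := {
  barrier_closed : forall t, 0 < t -> closed (D t) ;
  barrier_antitone : forall s t, 0 < s -> s <= t -> D t `<=` D s ;
  barrier_left : forall t x, 0 < t -> (forall s, 0 < s -> s < t -> D s x) ->
    D t x }.

Definition hits D t p := exists s, [/\ 0 < s, s < t & D s (p s)].

Lemma barrier_cst (F : set R) : closed F -> barrier (fun=> F).
Proof.
move=> cF; split; [by []|by move=> s t _ _ x|move=> t x t0 H].
have t20 : 0 < t / 2 by rewrite divr_gt0.
by apply: (H _ t20); lra.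
Qed.

(** The graph of a barrier is closed in space-time: at an earlier time [r] the
    closed set [D r] still misses [p t], and it contains all later ones. *)
Lemma barrier_away D t p : barrier D -> contpath p -> 0 < t -> ~ D t (p t) ->
  exists2 e : R, 0 < e & forall s x : R, 0 < s -> `|s - t| < e -> `|p s - x| < e ->
    ~ D s x.
Proof.
move=> bD cp t0 nD.
have [r [r0 rt nDr]] : exists r, [/\ 0 < r, r < t & ~ D r (p t)].
  apply: contrapT => H; apply: nD; apply: (barrier_left bD) => // s s0 st.
  by apply: contrapT => nDs; apply: H; exists s.
have oD : open (~` D r) by apply: closed_openC; exact: (barrier_closed bD).
have : nbhs (p t) (~` D r) by apply: open_nbhs_nbhs; split.
move=> /nbhs_ballP[e /= e0 eP].
have e20 : 0 < e / 2 by rewrite divr_gt0.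
have [d d0 dP] := contpath_eps cp (ltW t0) e20.
exists (Num.min (Num.min d (e / 2)) (t - r)).
  by rewrite !lt_min d0 e20 subr_gt0.
move=> s x s0; rewrite !lt_min => /andP[/andP[sd _] str].
move=> /andP[/andP[_ pse] _] Ds.
apply: (eP x).
  rewrite /ball/= -(subrKA (p s)) [e]splitr.
  by apply: le_lt_trans (ler_normD _ _) _; rewrite ltrD// distrC dP// ltW.
apply: (barrier_antitone bD r0 _ Ds).
by move: str; rewrite ltr_distl => /andP[]; lra.
Qed.

(** An entry in an open interval of times is seen on rational times: shortly
    before an entry the path is close to the barrier, since the barrier was
    larger then; conversely, approximate entries in a compact interval
    accumulate at an entry, since the graph of the barrier is closed. *)
Lemma hits_rat D t p : barrier D -> contpath p ->
  hits D t p <-> exists n, forall m, exists q : rat,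
    [/\ n.+1%:R^-1 <= ratr q :> R, ratr q <= t - n.+1%:R^-1 &
        exists2 x, D (ratr q) x & `|p (ratr q) - x| < m.+1%:R^-1].
Proof.
move=> bD cp; split.
  move=> [s [s0 st Ds]].
  have /small_invS[n] : 0 < Num.min (s / 2) (t - s).
    by rewrite lt_min divr_gt0//= subr_gt0.
  rewrite lt_min => /andP[n1 n2].
  exists n => m; set a : R := n.+1%:R^-1 in n1 n2 *.
  have m0 : 0 < m.+1%:R^-1 :> R by rewrite invr_gt0.
  have [d d0 dP] := contpath_eps cp (ltW s0) m0.
  have /rat_in_itvoo[q] : Num.max (s - d) (s / 2) < s.
    rewrite gt_max; apply/andP; split; first lra.
    by rewrite ltr_pdivrMr// ltr_pMr// ltr1n.
  rewrite in_itv/= gt_max => /andP[/andP[q1 q2] q3].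
  exists q; split; [lra|lra|exists (p s)].
    by apply: (barrier_antitone bD _ (ltW q3) Ds); lra.
  by apply: dP; [lra|rewrite ltr_distl; apply/andP; split; lra].
move=> [n nP]; apply: contrapT => nh.
set a : R := n.+1%:R^-1 in nP.
have a0 : 0 < a by rewrite invr_gt0.
have /compact_near_coveringP cK := @segment_compact _ a (t - a).
have [s /= sK|m _ /(_ m (leqnn _)) mP] := cK nat \oo (fun m s => forall x, `|p s - x| < m.+1%:R^-1 -> ~ D s x) _.
  move: sK; rewrite in_itv/= => /andP[as_ sa].
  have s0 : 0 < s by lra.
  have [|e e0 eP] := barrier_away bD cp s0.
    by move=> Ds; apply: nh; exists s; split => //; lra.
  have : \forall u \near s, 0 < u /\ `|u - s| < e.
    near=> u; split.
      by near: u; exact: lt_nbhsr.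
    by rewrite distrC; near: u; exact: cvgr_dist_lt.
  move=> H2; exists ([set u : R | 0 < u /\ `|u - s| < e],
                    [set m : nat | m.+1%:R^-1 < e]).
    by split => //=; exact: (near_infty_natSinv_lt (PosNum e0)).
  move=> [u m] /= [[u0 us] me] x ux.
  by apply: eP => //; exact: lt_trans ux me.
have [q [q1 q2 [x Dx px]]] := nP m.
by apply: (mP (ratr q)) px Dx => /=; rewrite in_itv/= q1.
Unshelve. all: by end_near. Qed.

Lemma hits_observable D t : barrier D -> observable `[0, t]%classic (hits D t).
Proof.
move=> bD; apply: (@observable_ext _ _ (\bigcup_n \bigcap_m [set p | exists q : rat,
    [/\ n.+1%:R^-1 <= ratr q :> R, ratr q <= t - n.+1%:R^-1 &
        exists2 x, D (ratr q) x & `|p (ratr q) - x| < m.+1%:R^-1]])); last first.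
  move=> p cp; rewrite hits_rat//; split.
    by move=> [n _ H]; exists n => m; exact: H.
  by move=> [n H]; exists n => // m _; exact: H.
apply: observable_bigcup => n; apply: observable_bigcap => m.
apply: observable_exists_rat => q.
have [nq|nq] := boolP ((n.+1%:R^-1 <= ratr q :> R) && (ratr q <= t - n.+1%:R^-1)); last first.
  apply: observable_ext (observable0 _) _ => p _; split => // -[q1 q2].
  by move: nq; rewrite q1 q2.
apply: observable_ext.
  apply: (@observable_coord _ _ (ratr q) (\bigcup_(x in D (ratr q)) ball x m.+1%:R^-1)).
    have n0 : 0 < n.+1%:R^-1 :> R by rewrite invr_gt0.
    move/andP : nq => [q1 q2]; rewrite /= in_itv/=.
    by rewrite (le_trans (ltW n0) q1) (le_trans q2)// gerBl ltW.
  apply: open_measurable; apply: bigcup_open => x _; exact: ball_open.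
move=> p _; move/andP : nq => [q1 q2]; split => [[x Dx /= px]|[_ _ [x Dx px]]].
  by split => //; exists x => //; rewrite distrC.
by exists x => //; rewrite /ball/= distrC.
Qed.

End hitting.

(** * Entry times and first visits *)
Section first_hitting.
Context {R : realType}.
Implicit Types (p : R -> R) (D : R -> set R) (s t x y z : R).

Definition entry D p : \bar R := entry_time (fun t (p : R -> R) => p t) D p.

Lemma entry_ge0 D p : (0 <= entry D p)%E.
Proof. by apply: le_ereal_inf_tmp => _ [t [t0 _] <-]; rewrite lee_fin ltW. Qed.

Lemma entry_lt D t p : (entry D p < t%:E)%E <-> hits D t p.
Proof.
split.
  move=> /ereal_inf_lt[_ [s [s0 Ds] <-]]; rewrite lte_fin => st.
  by exists s.
move=> [s [s0 st Ds]]; apply: (@le_lt_trans _ _ s%:E); last by rewrite lte_fin.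
by apply: ereal_inf_lbound; exists s.
Qed.

Lemma hitsW D s t p : s <= t -> hits D s p -> hits D t p.
Proof. by move=> st [u [u0 us Du]]; exists u; split => //; exact: lt_le_trans us st. Qed.

Lemma entry_lty D p : (entry D p < +oo)%E <-> exists t, hits D t p.
Proof.
split.
  move=> /ereal_inf_lt[_ [s [s0 Ds] <-]] _.
  by exists (s + 1), s; split => //; rewrite ltrDl.
by move=> [t /entry_lt ht]; apply: lt_trans ht _; rewrite ltry.
Qed.

Lemma entry_fine D p : (exists t, hits D t p) -> entry D p = (fine (entry D p))%:E.
Proof.
move=> /entry_lty Dp; rewrite fineK// ge0_fin_numE//; exact: entry_ge0.
Qed.

(** The infimum is attained because the graph of the barrier is closed. *)
Lemma entry_attained D p h : barrier D -> contpath p -> 0 < h ->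
  entry D p = h%:E -> D h (p h).
Proof.
move=> bD cp h0 Dh; apply: contrapT => nD.
have [e e0 eP] := barrier_away bD cp h0 nD.
have [d d0 dP] := contpath_eps cp (ltW h0) e0.
have : (entry D p < (h + Num.min e d)%:E)%E.
  by rewrite Dh lte_fin ltrDl lt_min e0.
move=> /entry_lt[s [s0 sh Ds]].
have hs : h <= s.
  rewrite leNgt; apply/negP => sh'.
  suff : (entry D p < h%:E)%E by rewrite Dh ltxx.
  by apply/entry_lt; exists s.
have : `|s - h| < e /\ `|s - h| < d.
  by rewrite ger0_norm ?subr_ge0//; move: sh; rewrite -ltrBlDl lt_min => /andP[].
by move=> [se sd]; apply: (eP s (p s)) => //; rewrite subrr normr0.
Qed.

Definition entered D p := exists t, hits D t p.

(** The value is 0 for a path that never enters the barrier. *)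
Definition entry_instant D p : R := fine (entry D p).

Definition entry_point D p : R := p (entry_instant D p).

Lemma entry_instant_ge0 D p : 0 <= entry_instant D p.
Proof. exact/fine_ge0/entry_ge0. Qed.

Lemma entry_instant_out D p : ~ entered D p -> entry_instant D p = 0.
Proof.
move=> nD; suff E : entry D p = +oo%E by rewrite /entry_instant E.
by apply: contrapT => /eqP; rewrite -ltey => /entry_lty.
Qed.

Lemma entry_instant_lt D t p : entered D p -> entry_instant D p < t <-> hits D t p.
Proof. by move=> /entry_fine Dp; rewrite -lte_fin -Dp; exact: entry_lt. Qed.

Lemma entry_instant_hits D t p : hits D t p -> entry_instant D p < t.
Proof. by move=> h; apply/entry_instant_lt => //; exists t. Qed.

Lemma entry_instant_le D u p : 0 < u -> D u (p u) -> entry_instant D p <= u.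
Proof.
move=> u0 Du; rewrite leNgt; apply/negP => ut.
have : hits D ((u + entry_instant D p) / 2) p by exists u; split => //; lra.
by move=> /entry_instant_hits; lra.
Qed.

Lemma entry_instant_le_entry_point D E p : 0 < entry_instant E p -> D (entry_instant E p) (entry_point E p) ->
  entry_instant D p <= entry_instant E p.
Proof. exact: entry_instant_le. Qed.

Lemma entry_instant_attained D p : barrier D -> contpath p -> entered D p -> 0 < entry_instant D p ->
  D (entry_instant D p) (entry_point D p).
Proof. by move=> bD cp eD t0; exact: entry_attained bD cp t0 (entry_fine eD). Qed.

(** This says that the entry into [D] strictly precedes the entry into [E], if
    the latter takes place at all. The rational time makes it an event. *)
Definition earlier D E p := exists q : rat, hits D (ratr q) p /\ ~ hits E (ratr q) p.

Lemma earlierP D E t p : hits D t p -> ~ hits E t p -> earlier D E p.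
Proof.
move=> hD nE; have dt := entry_instant_hits hD.
have /rat_in_itvoo[q] := dt; rewrite in_itv/= => /andP[q1 q2].
exists q; split; first by apply/entry_instant_lt => //; exists t.
by apply: contra_not nE; apply: hitsW; exact: ltW.
Qed.

Lemma earlier_lt D E p : entered E p -> earlier D E p -> entry_instant D p < entry_instant E p.
Proof.
move=> eE [q [hD nE]]; apply: lt_le_trans (entry_instant_hits hD) _.
by rewrite leNgt; apply/negP => /(entry_instant_lt _ eE).
Qed.

Lemma lt_earlier D E p : entered D p -> entry_instant D p < entry_instant E p -> earlier D E p.
Proof.
move=> eD DE; apply: (@earlierP _ _ (entry_instant E p)); first exact/entry_instant_lt.
by move=> /entry_instant_hits; rewrite ltxx.
Qed.

Definition hit z : R -> (R -> R) -> Prop := hits (fun=> [set z]).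

Definition reach z : (R -> R) -> Prop := entered (fun=> [set z]).

Definition first z : (R -> R) -> R := entry_instant (fun=> [set z]).

Definition before (b a : R) : (R -> R) -> Prop := earlier (fun=> [set b]) (fun=> [set a]).

Definition shift z p : R -> R := fun s => p (first z p + s).

Lemma barrier_pt z : barrier (fun=> [set z]).
Proof. exact/barrier_cst/closed_eq. Qed.

Lemma first_ge0 z p : 0 <= first z p.
Proof. exact: entry_instant_ge0. Qed.

Lemma first_lt z p t : reach z p -> first z p < t <-> hit z t p.
Proof. exact: entry_instant_lt. Qed.

Lemma hit_reach z t p : hit z t p -> reach z p.
Proof. by exists t. Qed.

Lemma first_lt_hit z p t : hit z t p -> first z p < t.
Proof. exact: entry_instant_hits. Qed.

Lemma first_le z p u : 0 < u -> p u = z -> first z p <= u.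
Proof. exact: (@entry_instant_le (fun=> [set z])). Qed.

Lemma first_val z p : contpath p -> reach z p -> p (first z p) = z.
Proof.
move=> cp rz; have := first_ge0 z p.
rewrite le_eqVlt => /predU1P[h0|h0]; last first.
  exact: entry_instant_attained (barrier_pt z) cp rz h0.
apply: contrapT => pz.
have e0 : 0 < `|z - p (first z p)| by rewrite normr_gt0 subr_eq0; apply/eqP; exact: nesym.
have [d d0 dP] := contpath_eps cp (first_ge0 z p) e0.
have /(first_lt d rz) [u [u0 ud /= puz]] : first z p < d by rewrite -h0.
have := dP u (ltW u0); rewrite -h0 subr0 gtr0_norm// => /(_ ud).
by rewrite puz h0 ltxx.
Qed.

Lemma first_gt0 z p : contpath p -> reach z p -> p 0 <> z -> 0 < first z p.
Proof.
move=> cp rz p0; rewrite lt_neqAle first_ge0 andbT; apply/eqP => h0.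
by apply: p0; rewrite -(first_val cp rz) -h0.
Qed.

Lemma contpath_add (h : R) p : contpath p -> 0 <= h -> contpath (fun s => p (h + s)).
Proof.
move=> cp h0; apply/subspace_continuousP => s; rewrite /= in_itv/= andbT => s0.
apply/cvgrPdist_lt => e e0; rewrite near_withinE.
have [d d0 dP] := contpath_eps cp (addr_ge0 h0 s0) e0.
exists d => // u /= us; rewrite in_itv/= andbT => u0.
have /dP : 0 <= h + u by rewrite addr_ge0.
by rewrite opprD addrACA subrr add0r distrC => /(_ us); rewrite distrC.
Qed.

Lemma contpath_shift z p : contpath p -> contpath (shift z p).
Proof. by move=> cp; apply: contpath_add cp (first_ge0 z p). Qed.

Lemma hit_shift z b t p : hit z t (shift b p) <->
  exists u, [/\ first b p < u, u < first b p + t & p u = z].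
Proof.
split=> [[s [s0 st pz]]|[u [u0 ut pz]]].
  by exists (first b p + s); split; rewrite ?ltrDl ?ltrD2l.
exists (u - first b p); split; rewrite ?subr_gt0 ?ltrBlDl//.
by rewrite /= /shift subrKC.
Qed.

(** Strict betweenness, whatever the order of the end points: all the lemmas on
    passages from one level to another serve for both directions. *)
Definition between (a b c : R) : bool := (Num.min a c < b) && (b < Num.max a c).

Lemma betweenC (a b c : R) : between a b c = between c b a.
Proof. by rewrite /between minC maxC. Qed.

Lemma betweenP (a b c : R) : between a b c <-> a < b < c \/ c < b < a.
Proof.
rewrite /between; case: (leP a c) => ac.
  split=> [->|[//|/andP[cb ba]]]; first by left.
  by have := lt_trans cb ba; rewrite ltNge ac.
split=> [->|[/andP[ab bc]|//]]; first by right.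
by have := lt_trans ab bc; rewrite ltNge ltW.
Qed.

Lemma contpath_ivt p (a b c : R) s t : contpath p -> 0 <= s -> s < t ->
  p s = a -> p t = c -> between a b c -> exists u, [/\ s < u, u < t & p u = b].
Proof.
move=> cp s0 st ps pt /andP[abc1 abc2].
have : Num.min (p s) (p t) <= b <= Num.max (p s) (p t).
  by rewrite ps pt !ltW.
move=> /(IVT (ltW st) (contpath_segment (b := t) cp s0))[u].
rewrite in_itv/= => /andP[su ut] pu; exists u; split => //.
  rewrite lt_neqAle su andbT; apply/eqP => us; move: abc1 abc2.
  by rewrite -pu -us ps gt_min lt_max !ltxx /= => /lt_trans/[apply]; rewrite ltxx.
rewrite lt_neqAle ut andbT; apply/eqP => us; move: abc1 abc2.
by rewrite -pu us pt gt_min lt_max !ltxx !orbF => /lt_trans/[apply]; rewrite ltxx.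
Qed.

End first_hitting.

(** * Probabilities of path events *)
Lemma measurable_exists (C : countType) d (T : measurableType d) (B : C -> set T) :
  (forall c, measurable (B c)) -> measurable [set w | exists c, B c w].
Proof.
move=> mB; rewrite [S in measurable S](_ : _ = \bigcup_n
    (if unpickle n is Some c then B c else set0)).
  by apply: bigcupT_measurable => n; case: unpickle => [c|]; [exact: mB|exact: measurable0].
apply/seteqP; split => w /=.
  by move=> [c Bc]; exists (pickle c); [exact: Logic.I|rewrite pickleK].
by move=> [n _]; case: unpickle => // c Bc; exists c.
Qed.

Lemma measurable_prop d (T : measurableType d) (Q : Prop) :
  measurable [set _ : T | Q].
Proof.
have [q|q] := pselect Q.
  by rewrite [S in measurable S](_ : _ = setT) //; apply/seteqP; split.
by rewrite [S in measurable S](_ : _ = set0) //; apply/seteqP; split.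
Qed.

Lemma measurable_forall (C : countType) d (T : measurableType d) (B : C -> set T) :
  (forall c, measurable (B c)) -> measurable [set w | forall c, B c w].
Proof.
move=> mB; rewrite -[S in measurable S]setCK; apply: measurableC.
rewrite [S in measurable S](_ : _ = [set w | exists c, (~` B c) w]).
  by apply: measurable_exists => c; exact: measurableC.
apply/seteqP; split => w /=; first by move/existsNP.
by move=> [c nB] /(_ c).
Qed.

Lemma measurable_ext d (T : measurableType d) (A B : set T) :
  measurable A -> (forall w, A w <-> B w) -> measurable B.
Proof. by move=> mA AB; congr measurable: mA; apply/seteqP; split => w /AB. Qed.

Section process.
Context {R : realType} {d : measure_display} {T : measurableType d}.
Context (P : R -> probability T R) (X : R -> T -> R).
Hypothesis hX : diffusion P X.
Implicit Types (p : R -> R) (D : R -> set R) (s t x y z : R).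
Implicit Types (A B : set (R -> R)).

Notation path w := (fun t : R => X t w).
Notation ev A := [set w | A (path w)].

Lemma path_cont w : contpath (path w).
Proof. exact: (diffusion_continuous hX). Qed.
Arguments path_cont : clear implicits.

Lemma X_measurable s (M : set (measurableTypeR R)) : 0 <= s -> measurable M ->
  measurable [set w | M (X s w)].
Proof.
by move=> s0 mM; rewrite -[S in measurable S]setTI; exact: (diffusion_measurable hX).
Qed.

Lemma observable_measurable A : observable `[0, +oo[%classic A -> measurable (ev A).
Proof.
move=> [A' sA' AA']; rewrite [S in measurable S](_ : _ = ev A').
  apply: (coord_sigma_transfer (Y := X) (G := measurable) _ _ sA').
    exact: sigma_algebra_measurable.
  by move=> s M; rewrite /= in_itv/= andbT; exact: X_measurable.
by apply/seteqP; split => w /=; rewrite AA'//; exact: path_cont.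
Qed.

Lemma observable_past t A : observable `[0, t]%classic A -> past X t (ev A).
Proof.
move=> [A' sA' AA']; rewrite [S in past _ _ S](_ : _ = ev A').
  apply: (coord_sigma_transfer (Y := X) (G := past X t) _ _ sA').
    exact: smallest_sigma_algebra.
  move=> s M st mM; apply: sub_gen_smallest; exists s => //.
  by exists M => //; apply/seteqP; split => w /=; tauto.
by apply/seteqP; split => w /=; rewrite AA'//; exact: path_cont.
Qed.

(** By continuity, the position at the time [tau] exceeds [a] if and only if the
    positions at the rational times around [tau] exceed [a] by a margin. *)
Lemma X_at_measurable (tau : T -> R) : (forall w, 0 <= tau w) ->
  measurable_fun setT (tau : T -> measurableTypeR R) ->
  measurable_fun setT ((fun w => X (tau w) w) : T -> measurableTypeR R).
Proof.
move=> tau0 mtau.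
apply: (measurability (@RGenOInfty.G R)); first exact: RGenOInfty.measurableE.
move=> _ [_ [a ->] <-]; rewrite setTI.
pose good (q1 q2 r : rat) : bool := [&& (0 : R) <= ratr r, (ratr q1 : R) < ratr r & (ratr r : R) < ratr q2].
apply: (@measurable_ext _ _ [set w | exists c : rat * rat * nat,
  (ratr c.1.1 < tau w < ratr c.1.2) /\
  forall r : rat, good c.1.1 c.1.2 r ->
    a + c.2.+1%:R^-1 <= X (ratr r) w]).
  apply: measurable_exists => -[[q1 q2] m] /=.
  apply: (@measurable_ext _ _ ([set w | `]ratr q1, ratr q2[%classic (tau w)] `&`
    [set w | forall r : rat, good q1 q2 r ->
    a + m.+1%:R^-1 <= X (ratr r) w])); last by move=> w; rewrite /= in_itv/=; exact: iff_refl.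
  apply: measurableI.
    by rewrite -[S in measurable S]setTI; apply: mtau.
  apply: measurable_forall => r.
  have [rq|nr] := boolP (good q1 q2 r); last first.
    by apply: measurable_ext measurableT _ => w /=; split.
  have /and3P[r0 _ _] := rq.
  have := @X_measurable (ratr r) `[a + m.+1%:R^-1, +oo[%classic r0.
  move=> /(_ (measurable_itv _)) /measurable_ext; apply => w /=.
  by rewrite in_itv/= andbT; split => [//|]; exact.
move=> w; rewrite /= in_itv/= andbT; split; last first.
  move=> aX; have aX0 : 0 < (X (tau w) w - a) / 2 by rewrite divr_gt0// subr_gt0.
  have [m mP] := small_invS aX0.
  have [e e0 eP] := contpath_eps (path_cont w) (tau0 w) aX0.
  have /rat_in_itvoo[q1] : tau w - e < tau w by lra.
  rewrite in_itv/= => /andP[q1e q1t].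
  have /rat_in_itvoo[q2] : tau w < tau w + e by lra.
  rewrite in_itv/= => /andP[q2t q2e].
  exists (q1, q2, m) => /=; split; first by rewrite q1t.
  move=> r /and3P[r0 qr rq]; have := eP _ r0.
  move: mP; set b := m.+1%:R^-1 => mP /(_ _)/wrap[].
    by rewrite ltr_distl; apply/andP; split; lra.
  by rewrite ltr_distl => /andP[H1 H2]; lra.
move=> [[[q1 q2] m] /= [/andP[q1t q2t] H]].
have m0 : 0 < m.+1%:R^-1 :> R by rewrite invr_gt0.
rewrite ltNge; apply/negP => Xa.
have [e e0 eP] := contpath_eps (path_cont w) (tau0 w) m0.
have /rat_in_itvoo[r] : tau w < Num.min (tau w + e) (ratr q2).
  by rewrite lt_min q2t ltrDl e0.
rewrite in_itv/= lt_min => /andP[tr /andP[re rq]].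
have r0 : 0 <= ratr r :> R by rewrite ltW// (le_lt_trans (tau0 w)).
have := H r; rewrite /good r0 rq (lt_trans q1t tr) => /(_ isT).
have := eP _ r0; rewrite ltr_distl.
move: m0; set b := m.+1%:R^-1 => m0 /(_ _)/wrap[].
  by apply/andP; split; lra.
by rewrite ltr_distl => /andP[H1 H2] H3; lra.
Qed.

Lemma hits_measurable D t : barrier D -> measurable (ev (hits D t)).
Proof.
move=> bD; apply: observable_measurable.
apply: observableS (hits_observable t bD) => s /=.
by rewrite !in_itv/= andbT => /andP[].
Qed.

Lemma entered_measurable D : barrier D -> measurable (ev (entered D)).
Proof.
move=> bD; rewrite [S in measurable S](_ : _ =
  [set w | exists n : nat, hits D n%:R (path w)]).
  by apply: measurable_exists => n; exact: hits_measurable.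
apply/seteqP; split => w /= [t]; last by exists t%:R.
by move=> ht; exists (Num.truncn t).+1; apply: hitsW ht; exact/ltW/truncnS_gt.
Qed.

Lemma entry_instant_measurable D : barrier D ->
  measurable_fun setT ((fun w => entry_instant D (path w)) : T -> measurableTypeR R).
Proof.
move=> bD; apply: (measurability (@RGenInftyO.G R)); first exact: RGenInftyO.measurableE.
move=> _ [_ [a ->] <-]; rewrite setTI.
apply: (@measurable_ext _ _ ((ev (entered D) `&` ev (hits D a)) `|`
  (~` ev (entered D) `&` [set _ | 0 < a]))).
  apply: measurableU; apply: measurableI.
  - exact: entered_measurable.
  - exact: hits_measurable.
  - by apply: measurableC; exact: entered_measurable.
  - exact: measurable_prop.
move=> w; rewrite /= in_itv/=.
have [hw|hw] := pselect (entered D (path w)).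
  by rewrite entry_instant_lt//; tauto.
by rewrite entry_instant_out//; tauto.
Qed.

Lemma shift_measurable z B : observable `[0, +oo[%classic B ->
  measurable (ev (fun p => B (shift z p))).
Proof.
move=> [B' sB' BB']; rewrite [S in measurable S](_ : _ = ev (fun p => B' (shift z p))).
  apply: (coord_sigma_transfer (Y := fun s w => X (first z (path w) + s) w) (G := measurable) _ _ sB').
    exact: sigma_algebra_measurable.
  move=> s M; rewrite /= in_itv/= andbT => s0 mM.
  rewrite -[S in measurable S]setTI.
  apply: (X_at_measurable (tau := fun w => first z (path w) + s)) => //.
    by move=> w; rewrite addr_ge0// first_ge0.
  apply: measurable_funD => //.
  by apply: (entry_instant_measurable (barrier_pt z)).
by apply/seteqP; split => w /=; (rewrite BB'//; apply: contpath_shift; exact: path_cont).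
Qed.


Definition event A : Prop := measurable (ev A).

Lemma eventC A : event A -> event (~` A).
Proof. by move=> mA; exact: measurableC. Qed.

Lemma eventU A B : event A -> event B -> event (A `|` B).
Proof. by move=> mA mB; exact: measurableU. Qed.

Lemma eventI A B : event A -> event B -> event (A `&` B).
Proof. by move=> mA mB; exact: measurableI. Qed.

Lemma eventT : event setT.
Proof. exact: measurableT. Qed.

Lemma event_start x : event [set p | p 0 = x].
Proof. exact: (X_measurable (lexx 0) (measurable_set1 x)). Qed.

Lemma event_bigcup (A : nat -> set (R -> R)) :
  (forall n, event (A n)) -> event [set p | exists n, A n p].
Proof. by move=> mA; exact: measurable_exists. Qed.

Definition pr x A : R := fine (P x (ev A)).

Lemma prE x A : event A -> P x (ev A) = (pr x A)%:E.
Proof. by move=> mA; rewrite fineK// fin_num_measure. Qed.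

Lemma pr_ge0 x A : 0 <= pr x A.
Proof. exact: fine_ge0. Qed.

(** The starting point only has probability one, so that inclusions of events
    need to be proved only for paths with the right starting point; this is the
    form of [pr_le] below. *)
Lemma pr_startE x A : event A -> pr x ([set p | p 0 = x] `&` A) = pr x A.
Proof.
move=> mA; apply: EFin_inj; rewrite -!prE//; last first.
  by apply: eventI => //; exact: event_start.
have mS := event_start x.
have PS : P x (~` (ev [set p | p 0 = x])) = 0%E.
  by rewrite probability_setC// (diffusion_start hX) subee.
rewrite -[in RHS](setIT (ev A)) -(setUv (ev [set p | p 0 = x])) setIUr measureU//; last 3 first.
- exact: measurableI.
- by apply: measurableI => //; exact: measurableC.
- by rewrite setIACA setICr setI0.
rewrite [X in (_ + X)%E](_ : _ = 0%E) ?adde0 1?setIC//.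
apply/eqP; rewrite eq_le measure_ge0 andbT -PS.
apply: le_measure; rewrite ?inE.
- by apply: measurableI => //; exact: measurableC.
- exact: measurableC.
- by move=> w [].
Qed.

Lemma pr_le x A B : event A -> event B ->
  (forall p, contpath p -> p 0 = x -> A p -> B p) -> pr x A <= pr x B.
Proof.
move=> mA mB AB; rewrite -(pr_startE x mA).
have mSA : event ([set p | p 0 = x] `&` A).
  by apply: eventI => //; exact: event_start.
rewrite -lee_fin -!prE//; apply: le_measure; rewrite ?inE//.
by move=> w [/= w0]; apply: AB => //; exact: path_cont.
Qed.

Lemma pr_eq x A B : event A -> event B ->
  (forall p, contpath p -> p 0 = x -> A p <-> B p) -> pr x A = pr x B.
Proof.
by move=> mA mB AB; apply/eqP; rewrite eq_le !pr_le// => p cp p0 /AB; exact.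
Qed.

Lemma prT x : pr x setT = 1.
Proof. by rewrite /pr probability_setT. Qed.

Lemma pr0 x : pr x set0 = 0.
Proof. by rewrite /pr measure0. Qed.

Lemma pr_le1 x A : event A -> pr x A <= 1.
Proof. by move=> mA; rewrite -(prT x); apply: pr_le => //; exact: eventT. Qed.

Lemma prU_le x A B : event A -> event B -> pr x (A `|` B) <= pr x A + pr x B.
Proof.
move=> mA mB; have mU := eventU mA mB.
by rewrite -lee_fin EFinD -!prE//; exact: measureU2.
Qed.

Lemma prU x A B : event A -> event B ->
  (forall p, contpath p -> A p -> B p -> False) ->
  pr x (A `|` B) = pr x A + pr x B.
Proof.
move=> mA mB AB; have mU := eventU mA mB.
apply: EFin_inj; rewrite EFinD -!prE//; apply: measureU => //.
by apply/seteqP; split => w //= -[/AB]; apply; exact: path_cont.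
Qed.

Lemma prC x A : event A -> pr x (~` A) = 1 - pr x A.
Proof.
move=> mA; have mC := eventC mA.
have := prU x mA mC (fun p _ a na => na a).
by rewrite setUv prT => ->; rewrite addrC addKr.
Qed.

Lemma pr_null x A : event A -> (forall p, contpath p -> p 0 = x -> ~ A p) ->
  pr x A = 0.
Proof.
move=> mA nA; rewrite -(pr0 x); apply: pr_eq => //; first exact: measurable0.
by move=> p cp p0; split => // /(nA _ cp p0).
Qed.

Lemma pr_sure x A : event A -> (forall p, contpath p -> p 0 = x -> A p) ->
  pr x A = 1.
Proof.
by move=> mA nA; rewrite -(prT x); apply: pr_eq => //; [exact: eventT|split=> // _; exact: nA].
Qed.

Lemma pr_bigcup_approx x (A : nat -> set (R -> R)) (B : set (R -> R)) (e : R) :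
  (forall n, event (A n)) -> event B ->
  (forall n p, contpath p -> A n p -> A n.+1 p) -> 0 < e ->
  (forall p, contpath p -> p 0 = x -> B p -> exists n, A n p) ->
  exists n, pr x B - e < pr x (A n).
Proof.
move=> mA mB Anu e0 BA; apply: contrapT => /forallNP nP.
have mU := event_bigcup mA.
have BU : pr x B <= pr x [set p | exists n, A n p] by exact: pr_le.
have : pr x [set p | exists n, A n p] <= pr x B - e; last by lra.
rewrite -lee_fin -prE//.
have : (P x \o (fun n => ev (A n))) n @[n --> \oo] --> P x (\bigcup_n ev (A n)).
  apply: nondecreasing_cvg_mu => //; first exact: bigcupT_measurable.
  by apply/nondecreasing_seqP => n; apply/subsetPset => w; apply: Anu; exact: path_cont.
rewrite [X in _ --> P x X](_ : _ = ev [set p | exists n, A n p]); last first.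
  by apply/seteqP; split => w /= [n]; [exists n|exists n].
move=> H; rewrite -(cvg_lim _ H)//; apply: lime_le; first exact: cvgP H.
by apply: nearW => n /=; rewrite prE// lee_fin leNgt; apply/negP.
Qed.

Lemma pr_bigcup_pos x (A : nat -> set (R -> R)) : (forall n, event (A n)) ->
  0 < pr x [set p | exists n, A n p] -> exists n, 0 < pr x (A n).
Proof.
move=> mA; rewrite -lte_fin -prE; last exact: event_bigcup.
move=> H; apply: contrapT => /forallNP nP; move: H.
rewrite [X in P x X](_ : _ = \bigcup_n ev (A n)); last first.
  by apply/seteqP; split => w /= [n]; [exists n|exists n].
have : (P x (\bigcup_n ev (A n)) <= \sum_(n <oo) P x (ev (A n)))%E.
  by apply: measure_sigma_subadditive => //; exact: bigcupT_measurable.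
rewrite eseries0 => [/le_lt_trans/[apply]|n _ _]; first by rewrite ltxx.
rewrite prE//; congr EFin; apply/eqP; rewrite eq_le pr_ge0 andbT leNgt.
exact/negP/nP.
Qed.

(** * The strong Markov property at a first visit *)

(** The sigma-algebra of the first visit to [z]; its trace on the paths that
    never visit [z] is left free. *)
Definition known_at z A := forall t : R, 0 < t -> observable `[0, t]%classic (A `&` hit z t).

Lemma hit_observable z t : observable `[0, t]%classic (hit z t).
Proof. exact: hits_observable (barrier_pt z). Qed.

Lemma observable_oo t A : observable `[0, t]%classic A -> observable `[0, +oo[%classic A.
Proof.
by apply: observableS => s /=; rewrite !in_itv/= andbT => /andP[].
Qed.

Lemma hits_observable_oo D t : barrier D -> observable `[0, +oo[%classic (hits D t).
Proof. by move=> bD; exact: observable_oo (hits_observable t bD). Qed.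

Lemma earlier_observable D E : barrier D -> barrier E ->
  observable `[0, +oo[%classic (earlier D E).
Proof.
move=> bD bE; apply: observable_exists_rat => q; apply: observableI.
  exact: hits_observable_oo.
by apply: observableC; exact: hits_observable_oo.
Qed.

Lemma hit_observable_oo z t : observable `[0, +oo[%classic (hit z t).
Proof. exact: hits_observable_oo (barrier_pt z). Qed.

Lemma event_observable A : observable `[0, +oo[%classic A -> event A.
Proof. exact: observable_measurable. Qed.

Lemma event_hit z t : event (hit z t).
Proof. exact/event_observable/hit_observable_oo. Qed.

Lemma reach_nat z p : reach z p <-> exists n : nat, hit z n.+1%:R p.
Proof.
split => [[t ht]|[n]]; last by exists n.+1%:R.
by exists (Num.truncn t); apply: hitsW ht; exact/ltW/truncnS_gt.
Qed.

Lemma event_reach z : event (reach z).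
Proof.
have := event_bigcup (fun n => event_hit z n.+1%:R).
by move/measurable_ext; apply => w; split => /reach_nat.
Qed.

Lemma event_known_at z A : known_at z A -> event (A `&` reach z).
Proof.
move=> pA; have /event_bigcup : forall n : nat, event (A `&` hit z n.+1%:R).
  by move=> n; apply: event_observable; apply: observable_oo (pA _ _).
move/measurable_ext; apply => w /=; split => [[n [Aw hn]]|[Aw /reach_nat[n hn]]].
  by split => //; apply/reach_nat; exists n.
by exists n.
Qed.

Lemma event_shift z B : observable `[0, +oo[%classic B ->
  event [set p | B (shift z p)].
Proof. exact: shift_measurable. Qed.

(** At its first visit to [z] the path is at the deterministic point [z], so
    that the integral of the strong Markov property is a product. *)
Lemma strong_markov_hit x z A B : known_at z A -> observable `[0, +oo[%classic B ->
  pr x (A `&` reach z `&` [set p | B (shift z p)]) = pr x (A `&` reach z) * pr z B.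
Proof.
move=> pA oB; have [B' sB' BB'] := oB.
have mAr := event_known_at pA.
apply: EFin_inj; rewrite EFinM -!prE//; last 2 first.
- exact: event_observable.
- by apply: eventI => //; exact: event_shift.
pose tau := entry_time X (fun=> [set z]).
have mt : markov_time X tau.
  split => [w|t t0]; first exact: (entry_ge0 (fun=> [set z]) (path w)).
  have := observable_past (hit_observable z t).
  congr past; apply/seteqP; split => w /=.
    by move=> /entry_lt.
  by move=> /(entry_lt (fun=> [set z])).
have pp : past_plus X tau (ev A).
  move=> t t0; have := observable_past (pA t t0).
  congr past; apply/seteqP; split => w /= [Aw].
    by move=> /entry_lt.
  by move=> /(entry_lt (fun=> [set z])).
have rE w : (tau w < +oo)%E <-> reach z (path w).
  exact: (entry_lty (fun=> [set z]) (path w)).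
have := diffusion_strong_markov hX x mt pp sB'.
have -> : ev A `&` [set w | (tau w < +oo)%E] = ev (A `&` reach z).
  by apply/seteqP; split => w /= [Aw /rE].
rewrite [X in P x X = _](_ : _ = ev (A `&` reach z `&` [set p | B (shift z p)])); last first.
  apply/seteqP; split => w /= -[Aw].
    by move=> Bw; split => //; apply/BB' => //; apply: contpath_shift; exact: path_cont.
  by move=> /BB' Bw; split => //; apply: Bw; apply: contpath_shift; exact: path_cont.
move=> ->.
rewrite (_ : \int[_]_(_ in _) _ = \int[P x]_(w in ev (A `&` reach z)) cst (P z (ev B)) w)%E.
  by rewrite integral_cst// muleC.
apply: eq_integral => w; rewrite inE => -[Aw rw] /=.
have -> : X (fine (tau w)) w = z by exact: (first_val (path_cont w) rw).
congr (P z _); apply/seteqP; split => w' /=; rewrite BB'//; exact: path_cont.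
Qed.

(** The integral of a positive function over a set of positive probability is
    positive. *)
Lemma markov_pos x r A B : 0 <= r -> observable `[0, r]%classic A ->
  observable `[0, +oo[%classic B -> 0 < pr x A ->
  (forall p, contpath p -> A p -> 0 < pr (p r) B) ->
  event [set p | B (fun s => p (r + s))] /\
  0 < pr x (A `&` [set p | B (fun s => p (r + s))]).
Proof.
move=> r0 oA oB A0 AB; have [B' sB' BB'] := oB.
have mA : event A by exact: event_observable (observable_oo oA).
have mB : event [set p | B (fun s => p (r + s))].
  rewrite /event.
  apply: (@measurable_ext _ _ (ev (fun p => B' (fun s => p (r + s))))).
    apply: (coord_sigma_transfer (Y := fun s w => X (r + s) w) (G := measurable) _ _ sB').
      exact: sigma_algebra_measurable.
    move=> s M; rewrite /= in_itv/= andbT => s0 mM.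
    by apply: X_measurable => //; rewrite addr_ge0.
  move=> w /=; rewrite BB'//; exact: contpath_add (path_cont w) r0.
split => //; rewrite lt_neqAle pr_ge0 andbT; apply/eqP => E0.
pose tau : T -> \bar R := cst r%:E.
have mt : markov_time X tau.
  split => [w|t t0]; first by rewrite /tau lee_fin.
  exact: (observable_past (observable_prop `[0, t]%classic (r%:E < t%:E)%E)).
have pp : past_plus X tau (ev A).
  move=> t t0; apply: (observable_past (A := fun p => A p /\ (r%:E < t%:E)%E)).
  have [rt|rt] := ltP r t.
    apply: (@observable_ext _ _ A).
      apply: observableS oA => s /=; rewrite !in_itv/= => /andP[-> sr].
      by rewrite (le_trans sr (ltW rt)).
    by move=> p _; split => [|[]//]; rewrite lte_fin.
  apply: (@observable_ext _ _ set0); first exact: observable0.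
  by move=> p _; split => // -[_]; rewrite lte_fin ltNge rt.
have := diffusion_strong_markov hX x mt pp sB'.
have -> : ev A `&` [set w | (tau w < +oo)%E] = ev A.
  by apply/seteqP; split => w /= => [[]//|Aw]; rewrite ltry.
rewrite [X in P x X = _](_ : _ = ev (A `&` [set p | B (fun s => p (r + s))])); last first.
  apply/seteqP; split => w /= -[Aw] Bw; split => //; apply/BB' => //;
  exact: contpath_add (path_cont w) r0.
rewrite prE; last exact: eventI.
rewrite -E0 /tau /= => I0.
have mf : measurable_fun (ev A) (fun w => P (X r w) (ev B')).
  apply: (@measurable_funS _ _ _ _ setT) => //.
  apply: (measurableT_comp (f := fun x => P x (ev B') : \bar R) (diffusion_measurable_law hX sB')).
  exact: (diffusion_measurable hX).
have : (\int[P x]_(w in ev A) `|P (X r w) (ev B')| = 0)%E.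
  by rewrite [RHS]I0; apply: eq_integral => w _; rewrite gee0_abs.
move=> /(ae_eq_integral_abs _ mA mf)[N [mN N0 AN]].
have : (P x (ev A) <= P x N)%E.
  apply: le_measure; rewrite ?inE// => w Aw; apply: AN => /= /(_ Aw) PX0.
  have := AB _ (path_cont w) Aw; rewrite /pr.
  rewrite (_ : ev B = ev B') ?PX0 ?ltxx//.
  by apply/seteqP; split => w' /=; rewrite BB'//; exact: path_cont.
by rewrite N0 prE// lee_fin leNgt A0.
Qed.

Lemma known_atT z : known_at z setT.
Proof.
move=> t t0; apply: observableI; [exact: observableT|exact: hit_observable].
Qed.

Lemma known_at_hit z t : known_at z (hit z t).
Proof.
move=> s s0; apply: (@observable_ext _ _ (hit z (Num.min s t))).
  apply: observableS (hit_observable z _) => u /=.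
  by rewrite !in_itv/= le_min => /and3P[-> ->].
move=> p _; split => [h|[[u [u0 ut pu]] [v [v0 vs pv]]]].
  by split; apply: hitsW h; rewrite ge_min lexx ?orbT.
rewrite minEle; case: ifP => _; first by exists v.
by exists u.
Qed.

Lemma before_observable (b a : R) : observable `[0, +oo[%classic (before b a).
Proof. exact: earlier_observable (barrier_pt b) (barrier_pt a). Qed.

Lemma event_before (b a : R) : event (before b a).
Proof. exact: event_observable (before_observable b a). Qed.

Lemma beforeP (b a : R) t p : hit b t p -> ~ hit a t p -> before b a p.
Proof. exact: earlierP. Qed.

Lemma before_reach (b a : R) p : before b a p -> reach b p.
Proof. by move=> [q [hb _]]; exact: hit_reach hb. Qed.

Lemma known_at_before (b a : R) : known_at b (before b a).
Proof.
move=> t t0; apply: (@observable_ext _ _ [set p | exists q : rat,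
    (ratr q : R) < t /\ (hit b (ratr q) p /\ ~ hit a (ratr q) p)]).
  apply: (@observable_exists_rat _ _ (fun q : rat => [set p | (ratr q : R) < t /\ (hit b (ratr q) p /\ ~ hit a (ratr q) p)])) => q.
  have [qt|tq] := ltP (ratr q : R) t; last first.
    by apply: observable_ext (observable0 _) _ => p _; split => //= -[].
  have tt : `[0, ratr q : R]%classic `<=` `[0, t]%classic.
    by move=> s /=; rewrite !in_itv/= => /andP[-> sq]; rewrite (le_trans sq (ltW qt)).
  apply: observable_ext (observableS tt (observableI (hit_observable b (ratr q))
    (observableC (hit_observable a (ratr q))))) _ => p _ /=.
  by split => [|[]].
move=> p _; split => [[q [qt [hb ha]]]|[[q [hb ha]] ht]].
  by split; [exists q|apply: hitsW hb; exact: ltW].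
have h1 := first_lt_hit hb; have h2 := first_lt_hit ht.
have /rat_in_itvoo[q'] : first b p < Num.min (ratr q) t by rewrite lt_min h1.
rewrite in_itv/= lt_min => /and3P[q1 q2 q3]; exists q'; split => //; split.
  by apply/first_lt => //; exact: hit_reach hb.
by apply: contra_not ha; apply: hitsW; exact: ltW.
Qed.

(** * Hitting and exit probabilities of a recurrent diffusion *)

Hypothesis hrec : recurrent P X.

Lemma pr_reach x z : pr x (reach z) = 1.
Proof.
rewrite /pr [X in fine X](_ : _ = 1%E)// -(hrec x z).
by congr (P x _); apply/seteqP; split => w /= /(entry_lty (fun=> [set z]) (path w)).
Qed.

Lemma pr_reachI x z A : event A -> pr x (A `&` reach z) = pr x A.
Proof.
move=> mA; have mr := event_reach z; have mI := eventI mA mr.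
apply/eqP; rewrite eq_le pr_le//=; last by move=> p _ _ [].
have := prU_le x mI (eventC mr); rewrite prC// pr_reach subrr addr0; apply: le_trans.
apply: pr_le => //; first by apply: eventU => //; exact: eventC.
by move=> p _ _ Ap; have [?|?] := pselect (reach z p); [left|right].
Qed.

Lemma markov_ge x z A B C : event A -> known_at z A -> observable `[0, +oo[%classic B ->
  event C ->
  (forall p, contpath p -> p 0 = x -> A p -> reach z p -> B (shift z p) -> C p) ->
  pr x A * pr z B <= pr x C.
Proof.
move=> mA pA oB mC ABC; rewrite -(pr_reachI x z mA) -strong_markov_hit//.
apply: pr_le => //.
  by apply: eventI; [exact: event_known_at|exact: event_shift].
by move=> p cp p0 [[Ap rp] Bp]; exact: ABC.
Qed.

Lemma markov_le x z A B C : event A -> known_at z A -> observable `[0, +oo[%classic B ->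
  event C ->
  (forall p, contpath p -> p 0 = x -> reach z p -> C p -> A p /\ B (shift z p)) ->
  pr x C <= pr x A * pr z B.
Proof.
move=> mA pA oB mC ABC.
rewrite -(pr_reachI x z mA) -strong_markov_hit// -(pr_reachI x z mC).
apply: pr_le => //.
- by apply: eventI => //; exact: event_reach.
- by apply: eventI; [exact: event_known_at|exact: event_shift].
- by move=> p cp p0 [Cp rp]; have [] := ABC p cp p0 rp Cp.
Qed.

Lemma hit_visit z u t p : 0 < u -> u < t -> p u = z -> hit z t p.
Proof. by move=> u0 ut pu; exists u. Qed.

Lemma hit_through b z t p : contpath p -> between (p 0) b z -> hit z t p ->
  reach b p /\ hit z t (shift b p).
Proof.
move=> cp xbz [s [s0 st /= ps]].
have [u [u0 us pu]] := contpath_ivt cp (lexx 0) s0 erefl ps xbz.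
have rb : reach b p by exists (u + 1); apply: (hit_visit u0) => //; rewrite ltrDl.
split => //; apply/hit_shift; exists s; split => //.
  by apply/first_lt => //; exact: hit_visit pu.
by rewrite ltr_wpDl// first_ge0.
Qed.

Lemma hit_compose w z t t' p : hit w t p -> hit z t' (shift w p) ->
  hit z (t + t') p.
Proof.
move=> hw /hit_shift[u [u1 u2 pu]]; exists u; split => //.
  exact: le_lt_trans (first_ge0 _ _) u1.
by apply: lt_trans u2 _; rewrite ltrD2r; exact: first_lt_hit.
Qed.

Lemma pr_hit_chain x w z t t' :
  pr x (hit w t) * pr w (hit z t') <= pr x (hit z (t + t')).
Proof.
apply: markov_ge.
- exact: event_hit.
- exact: known_at_hit.
- exact: hit_observable_oo.
- exact: event_hit.
- by move=> p cp p0 hw _; exact: hit_compose.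
Qed.

(** A path from [x] to [z] passes through [b] on its way. *)
Lemma pr_hit_through x b z t : between x b z -> pr x (hit z t) <= pr b (hit z t).
Proof.
move=> xbz; rewrite -[leRHS]mul1r -(prT x); apply: markov_le.
- exact: eventT.
- exact: known_atT.
- exact: hit_observable_oo.
- exact: event_hit.
- move=> p cp p0 _ hz; split => //.
  by rewrite -p0 in xbz; have [] := hit_through cp xbz hz.
Qed.

Lemma pr_hit_mono x z s t : s <= t -> pr x (hit z s) <= pr x (hit z t).
Proof.
move=> st; apply: pr_le; [exact: event_hit|exact: event_hit|].
by move=> p _ _; exact: hitsW.
Qed.

Lemma pr_hit_large x z (e : R) : 0 < e -> exists n : nat, 1 - e < pr x (hit z n.+1%:R).
Proof.
move=> e0; have := @pr_bigcup_approx x (fun n => hit z n.+1%:R) (reach z) e.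
rewrite pr_reach; apply => //.
- by move=> n; exact: event_hit.
- exact: event_reach.
- by move=> n p _; apply: hitsW; rewrite ler_nat.
- by move=> p _ _ /reach_nat.
Qed.

Lemma pr_hit_small y a (e : R) : y <> a -> 0 < e ->
  exists2 t, 0 < t & pr y (hit a t) < e.
Proof.
move=> ya e0; have := @pr_bigcup_approx y (fun n => ~` hit a n.+1%:R^-1) setT e.
rewrite prT => H; have [//|//|n p _|p cp p0 _|n] := H _ _ _ e0.
- by move=> n; apply: eventC; exact: event_hit.
- exact: eventT.
- by apply: contra_not; apply: hitsW; rewrite lef_pV2 ?posrE// ler_nat.
- have [rp|nr] := pselect (reach a p); last first.
    by exists 0%N; apply: contra_not nr; exact: hit_reach.
  have [|n nP] := small_invS (first_gt0 cp rp _); first by rewrite p0.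
  by exists n => /first_lt_hit /(lt_trans nP); rewrite ltxx.
- rewrite prC; last exact: event_hit.
  by exists n.+1%:R^-1; [rewrite invr_gt0|lra].
Qed.

Lemma not_before_late a x t p : contpath p -> hit x t p -> a <> x ->
  ~ before x a p -> reach a p /\ hit x (t - first a p) (shift a p).
Proof.
move=> cp [s [s0 st /= ps]] ax nb.
have ha r : s < r -> hit a r p.
  by move=> sr; apply: contrapT => na; apply: nb; apply: beforeP na; exact: hit_visit ps.
have ra : reach a p by exists (s + 1); apply: ha; rewrite ltrDl.
split => //; apply/hit_shift; exists s; split => //; last by rewrite subrKC.
rewrite lt_neqAle; apply/andP; split.
  by apply/eqP => h; apply: ax; rewrite -ps -h first_val.
by rewrite leNgt; apply/negP => /ha/first_lt_hit; rewrite ltxx.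
Qed.

(** The diffusion can leave an interval at either end. Otherwise every passage
    from [y] to [x] would first visit [a] and then come back through [y]. If
    [q t] is the probability of a visit to [x] before [t], then starting afresh
    at [a] gives the inequality [step] below. For [e] so small that [a] is not
    surely reached before [e], it propagates [q = 0] from [0] to all multiples
    of [e], against recurrence. *)
Lemma pr_before_gt0 a y x : between a y x -> 0 < pr y (before x a).
Proof.
move=> ayx; rewrite lt_neqAle pr_ge0 andbT; apply/eqP => b0.
have ay : y <> a by move=> E; move: ayx => /betweenP; rewrite E ltxx; lra.
have ax : a <> x by move=> E; move: ayx => /betweenP; rewrite E; lra.
have [e e0 he] := pr_hit_small ay ltr01.
pose q t := pr y (hit x t).
have qa t : pr a (hit x t) <= q t by exact: pr_hit_through.
have step t : q (t + e) <= pr y (hit a e) * q (t + e) + q t.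
  pose C1 := hit a e `&` reach a `&` [set p | hit x (t + e) (shift a p)].
  pose C2 := setT `&` reach a `&` [set p | hit x t (shift a p)].
  have m1 : event C1.
    apply: eventI; first by apply: event_known_at; exact: known_at_hit.
    by apply: event_shift; exact: hit_observable_oo.
  have m2 : event C2.
    apply: eventI; first by apply: event_known_at; exact: known_atT.
    by apply: event_shift; exact: hit_observable_oo.
  have le1 : pr y C1 <= pr y (hit a e) * q (t + e).
    rewrite strong_markov_hit; [|exact: known_at_hit|exact: hit_observable_oo].
    rewrite pr_reachI; last exact: event_hit.
    by apply: ler_wpM2l (qa _); exact: pr_ge0.
  have le2 : pr y C2 <= q t.
    rewrite strong_markov_hit; [|exact: known_atT|exact: hit_observable_oo].
    by rewrite pr_reachI ?prT ?mul1r; [exact: qa|exact: eventT].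
  have m12 := eventU m1 m2; have mb := event_before x a.
  have : q (t + e) <= pr y (before x a `|` (C1 `|` C2)).
    apply: pr_le; [exact: event_hit|exact: eventU|].
    move=> p cp p0 hx; have [b|nb] := pselect (before x a p); first by left.
    have [ra hs] := not_before_late cp hx ax nb.
    have [ef|fe] := ltP (first a p) e.
      right; left; split; first by split => //; exact/first_lt.
      by apply: hitsW hs; rewrite gerBl first_ge0.
    right; right; split => //; apply: hitsW hs.
    by rewrite lerBlDr lerD2l.
  move=> /le_trans; apply; apply: le_trans (prU_le _ mb m12) _; rewrite -b0 add0r.
  by apply: le_trans (prU_le _ m1 m2) _; exact: lerD.
have q0 : q 0 = 0.
  by apply: pr_null; [exact: event_hit|move=> p _ _ [s [s0 /lt_trans/(_ s0)]]; rewrite ltxx].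
have qn n : q (n%:R * e) = 0.
  elim: n => [|n IH]; first by rewrite mul0r.
  have := step (n%:R * e); rewrite IH addr0 -natr1 mulrDl mul1r.
  have v0 : 0 <= q (n%:R * e + e) by exact: pr_ge0.
  move=> v1; apply/eqP; rewrite eq_le v0 andbT.
  by have := pr_ge0 y (hit a e); nra.
have [n nP] := pr_hit_large y x (ltr01 : 0 < (1 : R)).
have : q n.+1%:R <= q ((Num.truncn (n.+1%:R / e)).+1%:R * e).
  by apply: pr_hit_mono; rewrite -ler_pdivrMr//; exact/ltW/truncnS_gt.
by rewrite qn leNgt => /negP; apply; move: nP; rewrite subrr.
Qed.

Lemma known_atC z A : known_at z A -> known_at z (~` A).
Proof.
move=> pA t t0.
apply: (@observable_ext _ _ (hit z t `&` ~` (A `&` hit z t))).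
  by apply: observableI; [exact: hit_observable|apply: observableC; exact: pA].
by move=> p _ /=; tauto.
Qed.

Lemma known_atI z A B : known_at z A -> known_at z B -> known_at z (A `&` B).
Proof.
move=> pA pB t t0.
apply: (@observable_ext _ _ ((A `&` hit z t) `&` (B `&` hit z t))).
  by apply: observableI; [exact: pA|exact: pB].
by move=> p _ /=; tauto.
Qed.

Lemma before_avoids z a p u : before z a p -> 0 < u -> u <= first z p -> p u <> a.
Proof.
move=> [q [hz ha]] u0 uz pu; apply: ha; apply: hit_visit u0 _ pu.
exact: le_lt_trans uz (first_lt_hit hz).
Qed.

Lemma first_avoids z p u : 0 < u -> u < first z p -> p u <> z.
Proof. by move=> u0 uz /(first_le u0); rewrite leNgt uz. Qed.


Lemma before_between a z p u : contpath p -> between a (p 0) z -> before z a p ->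
  0 < u -> u <= first z p -> between a (p u) z \/ p u = z.
Proof.
move=> cp ayz bza u0 uz.
have na := before_avoids bza.
have nz := @first_avoids z p.
have no_a : ~ between (p 0) a (p u).
  move=> /(contpath_ivt cp (lexx 0) u0 erefl erefl)[v [v0 vu pv]].
  by apply: (na v) pv => //; exact: le_trans (ltW vu) uz.
have no_z : ~ between (p 0) z (p u).
  move=> /(contpath_ivt cp (lexx 0) u0 erefl erefl)[v [v0 vu pv]].
  by apply: (nz v) pv => //; exact: lt_le_trans vu uz.
have := na u u0 uz; move: ayz no_a no_z; rewrite !betweenP.
by case: (ltgtP (p u) z); case: (ltgtP (p u) a); case: (ltgtP (p 0) z); case: (ltgtP (p 0) a); move=> *; try tauto; left; lra.
Qed.

(** * Remaining in an open set *)
Section staying.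
Variable F : set R.
Hypothesis cF : closed F.
Let stay s : set (R -> R) := ~` hits (fun=> F) s.

Lemma stay_observable s : observable `[0, +oo[%classic (stay s).
Proof. by apply: observableC; apply: observable_oo (hits_observable _ (barrier_cst cF)). Qed.

Lemma pr_stay_mono x s t : s <= t -> pr x (stay t) <= pr x (stay s).
Proof.
move=> st; apply: pr_le; try by apply: event_observable; exact: stay_observable.
by move=> p _ _; apply: contra_not; exact: hitsW.
Qed.

(** To survive from [y], go to [z] before leaving, which takes some time [e] at
    least with positive probability, and survive from [z]. *)
Lemma stay_step a y z : between a y z -> ~ F z -> (forall w, between a w z -> ~ F w) ->
  exists2 e : R, 0 < e &
    forall s, 0 <= s -> 0 < pr z (stay s) -> 0 < pr y (stay (s + e)).
Proof.
move=> ayz Fz Faz; have c0 := pr_before_gt0 ayz.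
have yz : y <> z by move=> E; move: ayz => /betweenP; rewrite E ltxx; lra.
have [e e0 he] := pr_hit_small yz c0.
exists e => // s s0 zs.
pose A := before z a `&` ~` hit z e.
have mb := event_before z a; have mh := event_hit z e.
have mA : event A by apply: eventI => //; exact: eventC.
have pA : known_at z A.
  by apply: known_atI; [exact: known_at_before|apply: known_atC; exact: known_at_hit].
have A0 : 0 < pr y A.
  have := prU_le y mA mh.
  have : pr y (before z a) <= pr y (A `|` hit z e).
    apply: pr_le => //; first exact: eventU.
    by move=> p _ _ bp; have [?|?] := pselect (hit z e p); [right|left].
  by lra.
apply: (lt_le_trans (mulr_gt0 A0 zs)); apply: markov_ge => //.
- exact: stay_observable.
- by apply: event_observable; exact: stay_observable.
move=> p cp p0 [bza nh] rz sp [u [u0 us Fu]].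
have ez : e <= first z p by rewrite leNgt; apply/negP => /(first_lt _ rz).
have [uf|fu] := leP u (first z p).
  have [] := before_between cp _ bza u0 uf; first by rewrite p0.
    by move=> /Faz.
  by move=> puz; apply: Fz; rewrite -puz.
apply: sp; exists (u - first z p); split; first by rewrite subr_gt0.
  by rewrite ltrBlDr; apply: lt_le_trans us _; rewrite lerD2l.
by rewrite /shift subrKC.
Qed.

(** Going back and forth between two points of a neighbourhood of [y], each
    passage lasting at least a fixed time, one survives for any length of
    time. *)
Lemma pr_stay_gt0 y s : ~ F y -> 0 < pr y (stay s).
Proof.
move=> Fy.
have /nbhs_ballP[e /= e0 eP] : nbhs y (~` F).
  by apply: open_nbhs_nbhs; split => //; exact: closed_openC.
have inF w : y - e < w -> w < y + e -> ~ F w.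
  by move=> w1 w2; apply: eP; rewrite /ball/= ltr_distl; apply/andP; split; lra.
pose z := y + e / 2.
have e2 : 0 < e / 2 by rewrite divr_gt0.
have [e1 e10 P1] : exists2 e1 : R, 0 < e1 &
    forall s, 0 <= s -> 0 < pr z (stay s) -> 0 < pr y (stay (s + e1)).
  apply: (@stay_step (y - e / 2)).
  - by apply/betweenP; left; rewrite /z; lra.
  - by apply: inF; rewrite /z; lra.
  - by move=> w /betweenP; rewrite /z => H; apply: inF; lra.
have [e1' e10' P1'] : exists2 e1 : R, 0 < e1 &
    forall s, 0 <= s -> 0 < pr y (stay s) -> 0 < pr z (stay (s + e1)).
  apply: (@stay_step (y + e / 2 + e / 4)).
  - by apply/betweenP; right; rewrite /z; lra.
  - by apply: inF; lra.
  - by move=> w /betweenP => H; apply: inF; lra.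
pose m := Num.min e1 e1'.
have m0 : 0 < m by rewrite lt_min e10.
have stay0 x : 0 < pr x (stay 0).
  rewrite pr_sure ?ltr01//; first by apply: event_observable; exact: stay_observable.
  by move=> p _ _ [u [u0 /lt_trans/(_ u0)]]; rewrite ltxx.
have H n : 0 < pr y (stay (n%:R * m)) /\ 0 < pr z (stay (n%:R * m)).
  elim: n => [|n [IH1 IH2]].
    by rewrite mul0r; split; exact: stay0.
  have nm : 0 <= n%:R * m by rewrite mulr_ge0// ltW.
  rewrite -natr1 mulrDl mul1r; split.
    apply: lt_le_trans (P1 _ nm IH2) _; apply: pr_stay_mono.
    by rewrite lerD2l ge_min lexx.
  apply: lt_le_trans (P1' _ nm IH1) _; apply: pr_stay_mono.
  by rewrite lerD2l ge_min lexx orbT.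
apply: lt_le_trans (H (Num.truncn (s / m)).+1).1 _; apply: pr_stay_mono.
by rewrite -ler_pdivrMr//; exact/ltW/truncnS_gt.
Qed.

End staying.

(** * Exit inequalities *)

Lemma before_through l b z p : contpath p -> between (p 0) b z -> before z l p ->
  before b l p /\ before z l (shift b p).
Proof.
move=> cp xbz [q [[u [u0 uq /= pu]] nl]].
have [rb [v [v0 vu' /= pv]]] := hit_through cp xbz (hit_visit u0 (ltr_pwDr ltr01 (lexx u)) pu).
have [w [w0 wu pw]] := contpath_ivt cp (lexx 0) u0 erefl pu xbz.
have bu : first b p < u by apply: le_lt_trans (first_le w0 pw) wu.
have bq : hit b (ratr q) p by apply/first_lt => //; exact: lt_trans bu uq.
split; first exact: beforeP bq nl.
apply: (@beforeP _ _ (ratr q - first b p)).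
  by apply/hit_shift; exists u; split => //; rewrite subrKC.
move=> /hit_shift[c [c1 c2 pc]]; apply: nl; exists c; split => //.
  exact: le_lt_trans (first_ge0 _ _) c1.
by move: c2; rewrite subrKC.
Qed.

Lemma before_compose l b z p : before b l p -> before z l (shift b p) -> before z l p.
Proof.
move=> bl [q [/hit_shift[u [u1 u2 pu]] nl]].
have u0 : 0 < u by exact: le_lt_trans (first_ge0 _ _) u1.
apply: (@beforeP _ _ (first b p + ratr q)); first by exists u.
move=> [c [c0 c1 /= pc]]; have [cb|bc] := leP c (first b p).
  exact: (before_avoids bl c0 cb).
by apply: nl; apply/hit_shift; exists c.
Qed.

Lemma beforeI b a p : contpath p -> reach b p -> p 0 <> a ->
  (forall u, 0 < u -> u <= first b p -> p u <> a) -> before b a p.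
Proof.
move=> cp rb p0a na; have [ra|nr] := pselect (reach a p); last first.
  by have [t ht] := rb; apply: (beforeP ht); apply: contra_not nr; exact: hit_reach.
apply: (@beforeP _ _ (first a p)); last by move=> /first_lt_hit; rewrite ltxx.
apply/first_lt => //; rewrite ltNge; apply/negP => ab.
by apply: (na (first a p)) => //; [exact: first_gt0|exact: first_val].
Qed.

Lemma pr_before_compl x a b : a <> b -> pr x (before a b) = 1 - pr x (before b a).
Proof.
move=> ab; have ma := event_before a b; have mb := event_before b a.
have disj p : before a b p -> before b a p -> False.
  move=> [q1 [a1 b1]] [q2 [b2 a2]].
  have [q12|q21] := leP (ratr q1 : R) (ratr q2).
    by apply: a2; exact: hitsW a1.
  by apply: b1; apply: hitsW b2; exact: ltW.
have := prU x ma mb (fun p _ => disj p).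
have -> : pr x (before a b `|` before b a) = 1; last by lra.
apply/eqP; rewrite eq_le pr_le1 ?andTb; last exact: eventU.
rewrite -(pr_reach x a); apply: pr_le; [exact: event_reach|exact: eventU|].
move=> p cp p0 ra; have [rb|nb] := pselect (reach b p); last first.
  by have [t ht] := ra; left; apply: (beforeP ht); apply: contra_not nb; exact: hit_reach.
case: (ltgtP (first a p) (first b p)) => fab.
- left; apply: (@beforeP _ _ (first b p)); first exact/first_lt.
  by move=> /first_lt_hit; rewrite ltxx.
- right; apply: (@beforeP _ _ (first a p)); first exact/first_lt.
  by move=> /first_lt_hit; rewrite ltxx.
- by case: ab; rewrite -(first_val cp ra) fab first_val.
Qed.

Lemma pr_before_through x b z l : between x b z ->
  pr x (before z l) <= pr x (before b l) * pr b (before z l).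
Proof.
move=> xbz; apply: markov_le.
- exact: event_before.
- exact: known_at_before.
- exact: before_observable.
- exact: event_before.
- by move=> p cp p0 _; apply: before_through => //; rewrite p0.
Qed.

Lemma pr_before_compose x b z l :
  pr x (before b l) * pr b (before z l) <= pr x (before z l).
Proof.
apply: markov_ge.
- exact: event_before.
- exact: known_at_before.
- exact: before_observable.
- exact: event_before.
- by move=> p cp p0 bl _; exact: before_compose.
Qed.

(** The probability of visiting [h] before [l], as a function of the starting
    point, is harmonic; the inequality needed here says that it is
    superharmonic. *)
Lemma pr_before_exit l h a x b : between a x b -> a <> l -> b <> l -> ~ between a l b ->
  pr x (before b a) * pr b (before h l) + (1 - pr x (before b a)) * pr a (before h l)
  <= pr x (before h l).
Proof.
move=> axb al bl nl.
have ab : a <> b by move=> E; move: axb => /betweenP; rewrite E; lra.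
rewrite -pr_before_compl// -[pr x (before b a)](pr_reachI x b (event_before b a)).
rewrite -[pr x (before a b)](pr_reachI x a (event_before a b)).
have oB := before_observable h l.
rewrite -!strong_markov_hit//; try exact: known_at_before.
have m1 : event (before b a `&` reach b `&` [set p | before h l (shift b p)]).
  by apply: eventI; [apply: event_known_at; exact: known_at_before|exact: event_shift].
have m2 : event (before a b `&` reach a `&` [set p | before h l (shift a p)]).
  by apply: eventI; [apply: event_known_at; exact: known_at_before|exact: event_shift].
rewrite -prU//; last first.
  move=> p _ [[[q1 [b1 a1]] _] _] [[[q2 [a2 b2]] _] _].
  have [q12|q21] := leP (ratr q1 : R) (ratr q2).
    by apply: b2; exact: hitsW b1.
  by apply: a1; apply: hitsW a2; exact: ltW.
apply: pr_le; [exact: eventU|exact: event_before|].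
have key c c' : between c' x c -> c <> l -> ~ between c' l c ->
    forall p, contpath p -> p 0 = x -> before c c' p -> before h l (shift c p) -> before h l p.
  move=> cxc cl nc p cp p0 bc; apply: before_compose; apply: beforeI => //.
  - exact: before_reach bc.
  - by rewrite p0 => E; apply: nc; rewrite -E.
  - move=> u u0 uc; have [] := before_between cp _ bc u0 uc; first by rewrite p0.
      by move=> + E; rewrite E.
    by move=> ->.
move=> p cp p0 [] [[bc _] bs]; first exact: (key b a axb bl nl p).
by apply: (key a b _ al _ p) => //; rewrite betweenC.
Qed.

(** A path that visits a point [V] outside of the interval first visits one of
    the end points. A visit to [b] consumes the time [m], as it almost surely
    does not occur earlier. *)
Lemma pr_hit_exit V a x b m t : between a x b -> a <> V -> b <> V -> ~ between a V b ->
  pr x (hit b m) = 0 ->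
  pr x (hit V t) <= pr x (before b a) * pr b (hit V (t - m)) +
                    (1 - pr x (before b a)) * pr a (hit V t).
Proof.
move=> axb aV bV nV hb0.
have ab : a <> b by move=> E; move: axb => /betweenP; rewrite E; lra.
rewrite -pr_before_compl// -[pr x (before b a)](pr_reachI x b (event_before b a)).
rewrite -[pr x (before a b)](pr_reachI x a (event_before a b)).
have oV s := hit_observable_oo V s.
rewrite -!strong_markov_hit//; try exact: known_at_before.
set C1 := _ `&` [set p | hit V (t - m) _]; set C2 := _ `&` [set p | hit V t _].
have m1 : event C1.
  by apply: eventI; [apply: event_known_at; exact: known_at_before|exact: event_shift].
have m2 : event C2.
  by apply: eventI; [apply: event_known_at; exact: known_at_before|exact: event_shift].
have mm := event_hit b m; have mV := event_hit V t.
have mU := eventU m1 m2.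
pose C3 := before b a `|` before a b.
have m3 : event C3 by apply: eventU; exact: event_before.
have C31 : pr x (~` C3) = 0.
  rewrite prC// prU; [|exact: event_before|exact: event_before|].
    by rewrite (pr_before_compl x ab) subrKC subrr.
  move=> p _ [q1 [b1 a1]] [q2 [a2 b2]].
  have [q12|q21] := leP (ratr q1 : R) (ratr q2).
    by apply: b2; exact: hitsW b1.
  by apply: a1; apply: hitsW a2; exact: ltW.
apply: le_trans (prU_le _ m1 m2).
rewrite -[leRHS]addr0 -hb0 -[leRHS]addr0 -C31.
apply: le_trans (lerD (prU_le _ mU mm) (lexx _)).
apply: le_trans (prU_le _ (eventU mU mm) (eventC m3)).
apply: pr_le => //; first by apply: eventU; [exact: eventU|exact: eventC].
have key c c' s p : contpath p -> p 0 = x -> between c' x c -> c <> V -> ~ between c' V c ->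
    before c c' p -> hit V s p -> hit V (s - first c p) (shift c p).
  move=> cp p0 cxc cV nc bc [u [u0 us /= pu]]; apply/hit_shift.
  exists u; rewrite subrKC; split => //; rewrite ltNge; apply/negP => uc.
  have [] := before_between cp _ bc u0 uc; first by rewrite p0.
    by rewrite pu.
  by rewrite pu => E; apply: cV.
move=> p cp p0 hV; have [c3|nc3] := pselect (C3 p); last by right.
left; case: c3 => bc.
  have [hm|nm] := pselect (hit b m p); first by right.
  left; left; split; first by split => //; exact: before_reach bc.
  apply: hitsW (key _ _ _ _ cp p0 axb bV nV bc hV).
  rewrite lerD2l lerN2 leNgt; apply/negP => /(first_lt _ (before_reach bc)).
  exact: nm.
left; right; split; first by split => //; exact: before_reach bc.
apply: (@hitsW _ _ (t - first a p)); first by rewrite gerBl first_ge0.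
by apply: (key _ _ _ _ cp p0 _ aV _ bc hV); rewrite betweenC.
Qed.

(** * Visits starting close to the target *)

(** Consider the last visit to [l] before the first visit to [x0]: until then
    the path keeps a positive distance from [x0]. A point [xs n] closer to [x0]
    than that is visited only later, and between this visit and the visit to
    [x0] the point [l] is avoided. *)
Lemma before_last_approach y x0 l (xs : nat -> R) p : contpath p -> p 0 = y ->
  x0 <> l -> y <> x0 -> reach x0 p -> (forall n, between y (xs n) x0) ->
  (forall e : R, 0 < e -> exists n, `|xs n - x0| < e) ->
  exists n, reach (xs n) p /\ before x0 l (shift (xs n) p).
Proof.
move=> cp p0 x0l yx0 rx yxs xsP.
have h0 : 0 < first x0 p by apply: first_gt0 => //; rewrite p0.
have ph := first_val cp rx; set h := first x0 p in h0 ph.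
have [|r r0 dP] := @contpath_eps _ p h `|x0 - l| cp (ltW h0).
  by rewrite normr_gt0 subr_eq0; apply/eqP.
have dl (u : R) : 0 <= u -> `|u - h| < r -> p u <> l.
  by move=> u0 /(dP _ u0) + pu; rewrite pu ph distrC ltxx.
pose t1 : R := Num.max 0 (h - r / 2).
have d2 : 0 < r / 2 by rewrite divr_gt0.
have t10 : 0 <= t1 by rewrite le_max lexx.
have t1h : t1 < h by rewrite gt_max h0/=; lra.
have [c + cP] : exists2 c, c \in `[0, t1] &
    forall t, t \in `[0, t1] -> `|p c - x0| <= `|p t - x0|.
  apply: EVT_min => // u; apply: (@continuous_comp _ _ _ _ (fun v : R => `|v - x0|)).
    exact: (contpath_segment (b := t1) cp (lexx 0)).
  apply: continuous_comp; last exact: norm_continuous.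
  by apply: continuousB; [exact: cvg_id|exact: cvg_cst].
rewrite in_itv/= => /andP[c0 ct1].
have m0 : 0 < `|p c - x0|.
  rewrite normr_gt0 subr_eq0; apply/eqP.
  move: c0; rewrite le_eqVlt => /predU1P[<-|c0]; first by rewrite p0.
  by apply: first_avoids => //; exact: le_lt_trans ct1 t1h.
have [n nP] := xsP _ m0; exists n.
have hx : hit x0 (h + 1) p by apply/first_lt => //; rewrite ltrDl.
have [rn hn] : reach (xs n) p /\ hit x0 (h + 1) (shift (xs n) p).
  by apply: hit_through => //; rewrite p0.
split => //; have fn0 := first_ge0 (xs n) p.
have fh : first (xs n) p < h.
  have := yxs n; rewrite -{1}p0 => /(contpath_ivt cp (lexx 0) h0 erefl ph)[u [u0 uh pu]].
  exact: le_lt_trans (first_le u0 pu) uh.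
have tf : t1 < first (xs n) p.
  rewrite ltNge; apply/negP => ft; move: nP; rewrite ltNge => /negP; apply.
  by have := cP (first (xs n) p); rewrite (first_val cp rn); apply; rewrite in_itv/= fn0.
apply: (@beforeP _ _ (h + r / 2 - first (xs n) p)).
  by apply/hit_shift; exists h; split => //; rewrite subrKC; lra.
move=> /hit_shift[u [u1 u2 pu]]; apply: (dl u) pu.
  by rewrite (le_trans fn0)// ltW.
have : h - r / 2 <= t1 by rewrite le_max lexx orbT.
by move: u2; rewrite subrKC => u2 ht; rewrite ltr_distl; apply/andP; split; lra.
Qed.

Lemma before_shift_shift b b' z l p : contpath p -> between (p 0) b b' -> between b b' z ->
  reach b p -> before z l (shift b p) ->
  reach b' p /\ before z l (shift b' p).
Proof.
move=> cp pbb bbz rb [q [/hit_shift[u [u1 u2 pu]] nl]].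
have fb := first_ge0 b p.
have [w [w1 w2 pw]] := contpath_ivt cp fb u1 (first_val cp rb) pu bbz.
have w0 : 0 < w by exact: le_lt_trans fb w1.
have rb' : reach b' p by exists u; exact: hit_visit pw.
have fw := first_le w0 pw.
have p0b' : p 0 <> b'.
  by move=> E; move: pbb => /betweenP; rewrite E; lra.
have f0 := first_gt0 cp rb' p0b'.
have [v [v0 v1 pv]] := contpath_ivt cp (lexx 0) f0 erefl (first_val cp rb') pbb.
have fv := first_le v0 pv.
split => //; apply: (@beforeP _ _ (first b p + ratr q - first b' p)).
  apply/hit_shift; exists u; split => //; last by rewrite subrKC.
  exact: le_lt_trans fw w2.
move=> /hit_shift[c [c1 c2 pc]]; apply: nl; apply/hit_shift; exists c; split => //.
  by apply: le_lt_trans fv (lt_trans v1 c1).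
by move: c2; rewrite subrKC.
Qed.

(** From a point close to [x0] the diffusion almost surely visits [x0] before
    [l]. Start at a point [y] between [l] and [x0]: along points [xs n] that
    approach [x0], the event that [l] is not visited between the first visits
    to [xs n] and to [x0] increases to a sure event, and its probability is
    that of visiting [x0] before [l] from [xs n]. *)
Lemma pr_before_near x0 l (e : R) : x0 <> l -> 0 < e ->
  exists2 x, between l x x0 & 1 - e < pr x (before x0 l).
Proof.
move=> x0l e0.
pose c (n : nat) : R := n.+3%:R^-1.
pose xs n := x0 + c n * (l - x0); pose y := x0 + 2^-1 * (l - x0).
have c0 n : 0 < c n by rewrite invr_gt0.
have c2 n : c n < 2^-1 by rewrite ltf_pV2 ?posrE// ltr_nat.
have cS n : c n.+1 < c n by rewrite ltf_pV2 ?posrE// ltr_nat.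
have lx : l - x0 <> 0 by move=> /subr0_eq E; apply: x0l.
have betweenc a b : 0 < b -> b < a -> between (x0 + a * (l - x0)) (x0 + b * (l - x0)) x0.
  move=> b0 ba; apply/betweenP; case: (ltgtP (l - x0) 0) => // h; [left|right];
  by apply/andP; split; nra.
have yE : y <> x0.
  by have := betweenc 2^-1 (c 0%N) (c0 _) (c2 _) => /betweenP + E; rewrite -/y E; lra.
have betweenc2 a b : 0 < b -> b < a -> forall a', a < a' ->
   between (x0 + a' * (l - x0)) (x0 + a * (l - x0)) (x0 + b * (l - x0)).
  move=> b0 ba a' aa; apply/betweenP; case: (ltgtP (l - x0) 0) => // h; [left|right];
  by apply/andP; split; nra.
pose E n := setT `&` reach (xs n) `&` [set p | before x0 l (shift (xs n) p)].
pose E' n := [set p | p 0 = y] `&` E n.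
have mE n : event (E n).
  apply: eventI; first by apply: event_known_at; exact: known_atT.
  by apply: event_shift; exact: before_observable.
have mE' n : event (E' n) by apply: eventI => //; exact: event_start.
have pE n : pr y (E' n) = pr (xs n) (before x0 l).
  rewrite pr_startE// strong_markov_hit; [|exact: known_atT|exact: before_observable].
  by rewrite pr_reachI ?prT ?mul1r//; exact: eventT.
have [//| |n p cp [p0 [[_ rx] bx]]|p cp p0 rx|n nP] :=
    @pr_bigcup_approx y E' (reach x0) e _ _ _ e0.
- exact: event_reach.
- have [| |r' b'] := before_shift_shift (b' := xs n.+1) cp _ _ rx bx.
  + by rewrite p0; apply: betweenc2.
  + exact: betweenc.
  + by split.
- have [| |n [rn bn]] := before_last_approach (xs := xs) cp p0 x0l yE rx.
  + by move=> n; exact: betweenc.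
  + move=> r r0.
    have [|n nP] := @small_invS _ (r / `|l - x0|).
      by rewrite divr_gt0// normr_gt0; apply/eqP.
    exists n; rewrite /xs addrC addKr normrM gtr0_norm// -ltr_pdivlMr ?normr_gt0//; last exact/eqP.
    by apply: lt_trans nP; rewrite ltf_pV2 ?posrE// ltr_nat.
  + by exists n; split.
exists (xs n); last by move: nP; rewrite pE pr_reach.
have := betweenc 1 (c n) (c0 n); rewrite mul1r subrKC /xs; apply.
by rewrite invf_lt1// ltr1n.
Qed.

(** * Time spent after a visit *)

Lemma pr_hit_le0 x z t : t <= 0 -> pr x (hit z t) = 0.
Proof.
move=> t0; apply: pr_null; first exact: event_hit.
by move=> p _ _ [s [s0 /lt_le_trans/(_ t0) /(lt_trans s0)]]; rewrite ltxx.
Qed.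

(** Delaying [f] by [l] steps of the lattice costs the last [l] terms of the
    sum. *)
Lemma shift_sum (f : R -> R) (dlt c : R) (J l : nat) : 0 <= dlt ->
  (forall t, t <= 0 -> f t = 0) -> (forall i, (i < l)%N -> c <= f (J%:R * dlt - i%:R * dlt)) ->
  \sum_(0 <= j < J) f (j.+1%:R * dlt - l%:R * dlt) <=
  \sum_(0 <= j < J) f (j.+1%:R * dlt) - l%:R * c.
Proof.
move=> d0 f0; elim: l => [|l IH] cf.
  by rewrite !mul0r subr0; apply: ler_sum => j _; rewrite subr0.
have {}IH := IH (fun i il => cf i (ltnW il)).
have := telescope_sumr (fun j => f (j%:R * dlt - l%:R * dlt)) (leq0n J).
rewrite sumrB mul0r sub0r (f0 (- _)) ?oppr_le0 ?mulr_ge0// subr0 => E.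
have cl := cf l (ltnSn l).
have -> : \sum_(0 <= j < J) f (j.+1%:R * dlt - l.+1%:R * dlt) =
          \sum_(0 <= j < J) f (j%:R * dlt - l%:R * dlt).
  apply: eq_bigr => j _; congr f; rewrite -!natr1; lra.
by rewrite -natr1; nra.
Qed.

(** Up to the factor [dlt], this is the expected length of the part of the
    interval from 0 to [J * dlt] that follows the first visit to [V], on a lattice
    of times. *)
Definition hit_sum V (dlt : R) (J : nat) x : R :=
  \sum_(0 <= j < J) pr x (hit V (j.+1%:R * dlt)).

Lemma hit_sum_through x b V dlt J : between x b V -> hit_sum V dlt J x <= hit_sum V dlt J b.
Proof. by move=> xbV; apply: ler_sum => j _; exact: pr_hit_through. Qed.

Lemma hit_sum_ge0 x V dlt J : 0 <= hit_sum V dlt J x.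
Proof. by apply: sumr_ge0 => j _; exact: pr_ge0. Qed.

Lemma hit_sum_le x V dlt J : hit_sum V dlt J x <= J%:R.
Proof.
apply: (@le_trans _ _ (\sum_(0 <= j < J) 1)).
  by apply: ler_sum => j _; apply: pr_le1; exact: event_hit.
by rewrite sumr_const_nat subn0.
Qed.

Lemma hit_sum_exit V a x b (dlt c : R) (J l : nat) :
  between a x b -> a <> V -> b <> V -> ~ between a V b -> 0 <= dlt ->
  pr x (hit b (l%:R * dlt)) = 0 ->
  (forall i, (i < l)%N -> c <= pr b (hit V (J%:R * dlt - i%:R * dlt))) ->
  hit_sum V dlt J x <= pr x (before b a) * (hit_sum V dlt J b - l%:R * c)
     + (1 - pr x (before b a)) * hit_sum V dlt J a.
Proof.
move=> axb aV bV nV d0 hb0 cP.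
have := shift_sum d0 (fun t => @pr_hit_le0 b V t) cP.
have p0 := pr_ge0 x (before b a).
move=> /(ler_wpM2l p0) H; apply: le_trans (lerD H (lexx _)).
rewrite !mulr_sumr -big_split/=; apply: ler_sum => j _.
exact: pr_hit_exit.
Qed.

(** * The scale function on the way from one point to another *)

Section scale.
Variables (y v : R).
Hypothesis yv : y <> v.

(** The line through [y] and [v] is parametrized so that [y] is at 0 and [v]
    is at 1. The scale function is taken between the points at -1 and 2. *)
Let pt (u : R) := y + u * (v - y).

Let vy : v - y <> 0. Proof. by move=> /subr0_eq E; apply: yv. Qed.

Lemma between_pt u1 u u3 : u1 < u3 -> between (pt u1) (pt u) (pt u3) = (u1 < u < u3).
Proof.
move=> u13; apply/idP/idP => [/betweenP|/andP[h1 h2]].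
  rewrite /pt; case: (ltgtP (v - y) 0) => // h [] /andP[h1 h2]; apply/andP; split; nra.
by apply/betweenP; rewrite /pt; case: (ltgtP (v - y) 0) => // h; [right|left]; apply/andP; split; nra.
Qed.

Lemma pt_surj x : exists u, x = pt u.
Proof.
by exists ((x - y) / (v - y)); rewrite /pt divfK ?subrKC//; exact/eqP.
Qed.

Lemma pt_neq u1 u2 : u1 < u2 -> pt u1 <> pt u2.
Proof.
move=> u12 E; have : (u1 - u2) * (v - y) = 0 by move: E; rewrite /pt; lra.
by move/eqP; rewrite mulf_eq0 => /orP[|] /eqP //; lra.
Qed.

Lemma pt_neq' u1 u2 : u1 < u2 -> pt u2 <> pt u1.
Proof. by move=> /pt_neq /nesym. Qed.

Definition scale (u : R) := pr (pt u) (before (pt 2) (pt (-1))).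

Lemma scale_gt0 (u : R) : -1 < u -> u < 2 -> 0 < scale u.
Proof. by move=> h1 h2; apply: pr_before_gt0; rewrite between_pt ?h1//; lra. Qed.

Lemma scale_lt (u u' : R) : -1 < u -> u < u' -> u' < 2 -> scale u < scale u'.
Proof.
move=> h1 h2 h3; apply: le_lt_trans (@pr_before_through _ (pt u') _ (pt (-1)) _) _.
  by rewrite (@between_pt u u' 2) ?h2//; lra.
have : 0 < pr (pt u) (before (pt (-1)) (pt u')).
  by apply: pr_before_gt0; rewrite betweenC between_pt ?h1//; lra.
rewrite pr_before_compl; last by apply: pt_neq; lra.
have := @scale_gt0 u'; rewrite -/(scale u') => /(_ _ _)/wrap[]; [lra|lra|].
by move: (scale u') (pr _ _) => a b a0 b0; nra.
Qed.

Lemma scale_left (u : R) (e : R) : -1 < u -> u < 2 -> 0 < e ->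
  exists u', [/\ -1 < u', u' < u & scale u - e < scale u'].
Proof.
move=> h1 h2 e0.
have [|x + xP] := @pr_before_near (pt u) (pt (-1)) e _ e0; first exact: pt_neq'.
have [u' E] := pt_surj x; rewrite E between_pt// => /andP[h3 h4].
exists u'; split => //.
have := pr_before_compose (pt u') (pt u) (pt 2) (pt (-1)).
rewrite -/(scale u) -/(scale u'); move: xP; rewrite E.
have s1 : scale u <= 1 by apply: pr_le1; exact: event_before.
have s0 := scale_gt0 h1 h2.
by move: (pr _ _) => a; nra.
Qed.

Lemma scale_right (u : R) (e : R) : -1 < u -> u < 2 -> 0 < e ->
  exists u', [/\ u < u', u' < 2 & scale u' < scale u + e].
Proof.
move=> h1 h2 e0.
have [|x + xP] := @pr_before_near (pt u) (pt 2) e _ e0; first exact: pt_neq.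
have [u' E] := pt_surj x; rewrite E betweenC between_pt// => /andP[h3 h4].
exists u'; split => //.
have := pr_before_compose (pt u') (pt u) (pt (-1)) (pt 2).
have h : pt (-1) <> pt 2 by apply: pt_neq; lra.
rewrite !(pr_before_compl _ h) -/(scale u) -/(scale u'); move: xP; rewrite E.
have s1 : scale u <= 1 by apply: pr_le1; exact: event_before.
have s0 := scale_gt0 h1 h2.
by move: (pr _ _) => a; nra.
Qed.

Lemma scale_continuous : {within `[0, 1], continuous scale}.
Proof.
apply: continuous_in_subspaceT => u; rewrite inE/= in_itv/= => /andP[u0 u1].
apply/cvgrPdist_lt => e e0.
have [||a [a1 a2 a3]] := @scale_left u e _ _ e0; [lra|lra|].
have [||b [b1 b2 b3]] := @scale_right u e _ _ e0; [lra|lra|].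
have : u \in `]a, b[ by rewrite in_itv/= a2.
move=> /near_in_itvoo; apply: filterS => w; rewrite in_itv/= => /andP[w1 w2].
rewrite ltr_distl; have := @scale_lt a w; have := @scale_lt w b.
move=> /(_ _ w2 b2)/wrap[]; first lra.
move=> H1 /(_ a1 w1)/wrap[]; first lra.
Qed.

Lemma scale_ivt c : scale 0 <= c <= scale 1 -> exists u, [/\ 0 <= u, u <= 1 & scale u = c].
Proof.
move=> cP; have [|u] := @IVT R scale 0 1 c ler01 scale_continuous _.
  have : scale 0 <= scale 1 by apply: ltW; apply: scale_lt; lra.
  by move=> h; rewrite min_l// max_r.
by rewrite in_itv/= => /andP[u0 u1] su; exists u.
Qed.


(** By continuity, the way from [y] to [v] is cut into steps of equal scale. *)
Lemma scale_grid n : (0 < n)%N -> exists g : nat -> R,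
  [/\ g 0%N = 0, g n = 1,
      forall k, (k <= n)%N -> scale (g k) = scale 0 + k%:R * ((scale 1 - scale 0) / n%:R),
      forall k, (k <= n)%N -> 0 <= g k <= 1 &
      forall k, (k < n)%N -> g k < g k.+1].
Proof.
move=> n0.
have s01 : scale 0 < scale 1 by apply: scale_lt; lra.
pose D := (scale 1 - scale 0) / n%:R.
have nR : 0 < n%:R :> R by rewrite ltr0n.
have D0 : 0 < D by rewrite divr_gt0// subr_gt0.
have nD : n%:R * D = scale 1 - scale 0 by rewrite /D mulrC divfK// gt_eqF.
have /choice[g gP] : forall k, exists u, (k <= n)%N ->
    [/\ 0 <= u, u <= 1 & scale u = scale 0 + k%:R * D].
  move=> k; have [kn|_] := leqP k n; last by exists 0.
  have [|u uP] := @scale_ivt (scale 0 + k%:R * D); last by exists u.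
  have kR : k%:R <= n%:R :> R by rewrite ler_nat.
  have : 0 <= k%:R :> R by [].
  by move=> k0; apply/andP; split; nra.
have inj a b : 0 <= a -> a <= 1 -> 0 <= b -> b <= 1 -> scale a = scale b -> a = b.
  move=> a0 a1 b0 b1 E; apply/eqP; rewrite eq_le !leNgt; apply/andP; split; apply/negP => ab.
    have := @scale_lt b a; rewrite E ltxx => H; suff : false by [].
    by apply: H; lra.
  have := @scale_lt a b; rewrite E ltxx => H; suff : false by [].
  by apply: H; lra.
exists g; split.
- by have [a0 a1 a2] := gP 0%N (leq0n _); apply: inj => //; rewrite a2 mul0r addr0.
- by have [a0 a1 a2] := gP n (leqnn _); apply: inj => //; rewrite a2 nD subrKC.
- by move=> k /gP[].
- by move=> k /gP[-> ->].
- move=> k kn; have [a0 a1 a2] := gP k (ltnW kn); have [b0 b1 b2] := gP k.+1 kn.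
  rewrite ltNge; apply/negP; rewrite le_eqVlt => /predU1P[E|ba].
    by move: b2; rewrite E a2 -natr1; nra.
  have h1 : -1 < g k.+1 by lra.
  have h2 : g k < 2 by lra.
  have := scale_lt h1 ba h2; rewrite a2 b2 -natr1.
  by rewrite mulrDl mul1r; lra.
Qed.

Lemma pr_hit_chainn (x : nat -> R) (t : nat -> R) n :
  (forall k, (k <= n)%N -> 0 < pr (x k) (hit (x k.+1) (t k))) ->
  0 < pr (x 0%N) (hit (x n.+1) (\sum_(0 <= k < n.+1) t k)).
Proof.
elim: n => [|n IH] H; first by rewrite big_nat1; exact: H.
rewrite big_nat_recr//=; apply: lt_le_trans (pr_hit_chain _ (x n.+1) _ _ _).
by apply: mulr_gt0; [apply: IH => k kn; apply: H; exact: leqW|exact: H].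
Qed.

(** The least duration of the passage from [x] to [z], rounded down to a
    multiple of [dlt]. *)
Lemma slow_lattice x z (dlt : R) : 0 < dlt -> exists l : nat,
  pr x (hit z (l%:R * dlt)) = 0 /\ 0 < pr x (hit z (l.+1%:R * dlt)).
Proof.
move=> d0; have ex : exists l : nat, 0 < pr x (hit z (l.+1%:R * dlt)).
  have [n nP] := pr_hit_large x z (ltr01 : 0 < (1 : R)).
  exists (Num.truncn (n.+1%:R / dlt)); rewrite subrr in nP.
  apply: lt_le_trans nP _; apply: pr_hit_mono.
  by rewrite -ler_pdivrMr//; exact/ltW/truncnS_gt.
have [l lP lmin] := ex_minnP ex; exists l; split => //.
case: l lP lmin => [|l] lP lmin; first by rewrite mul0r pr_hit_le0.
apply/eqP; rewrite eq_le pr_ge0 andbT leNgt; apply/negP => /lmin.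
by rewrite ltnn.
Qed.


(** * Absence of a speed limit *)

Section speed_limit.
Variables T0 M : nat.
Hypothesis M_gt0 : (0 < M)%N.

Let V := pt 2.
Let dlt : R := M%:R^-1.
Let J := (2 * T0 * M)%N.
Let F := hit_sum V dlt J.

Let dlt_gt0 : 0 < dlt. Proof. by rewrite invr_gt0 ltr0n. Qed.

Let M_dlt : M%:R * dlt = 1.
Proof. by rewrite /dlt mulfV// pnatr_eq0 -lt0n. Qed.

Let T0_dlt : (T0 * M)%N%:R * dlt = T0%:R.
Proof. by rewrite natrM -mulrA M_dlt mulr1. Qed.

Let J_dlt : J%:R * dlt = 2 * T0%:R.
Proof. by rewrite /J natrM -mulrA M_dlt mulr1 natrM. Qed.

Let F_mono a b : a < b -> b < 2 -> F (pt a) <= F (pt b).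
Proof.
move=> ab b2; apply: hit_sum_through; rewrite between_pt ?ab ?b2//.
exact: lt_trans b2.
Qed.

(** The two inequalities on an exit from an interval of the line, one for the
    time after the visit to [V] and one for the scale, with the same weight. *)
Lemma hit_sum_exit_pt a b u l : -1 < a -> a < u -> u < b -> b < 2 ->
  pr (pt u) (hit (pt b) (l%:R * dlt)) = 0 ->
  (l <= T0 * M)%N -> 2^-1 <= pr (pt b) (hit V T0%:R) ->
  exists p : R, [/\ 0 < p, p < 1,
    (1 - p) * (F (pt u) - F (pt a)) <= p * (F (pt b) - F (pt u) - l%:R * 2^-1) &
    p * scale b + (1 - p) * scale a <= scale u].
Proof.
move=> a1 au ub b2 slow lT half; exists (pr (pt u) (before (pt b) (pt a))).
have ab : a < b by exact: lt_trans ub.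
have aub : between (pt a) (pt u) (pt b) by rewrite between_pt// au.
have a2 : a < 2 by exact: lt_trans b2.
have b1 : -1 < b by exact: lt_trans ab.
have nV : ~ between (pt a) V (pt b).
  by rewrite between_pt// => /andP[_ /lt_trans/(_ b2)]; rewrite ltxx.
have nA : ~ between (pt a) (pt (-1)) (pt b).
  by rewrite between_pt// => /andP[/(lt_trans a1)]; rewrite ltxx.
have late i : (i < l)%N -> 2^-1 <= pr (pt b) (hit V (J%:R * dlt - i%:R * dlt)).
  move=> il; apply: le_trans half _; apply: pr_hit_mono.
  have : i%:R * dlt <= T0%:R.
    rewrite -T0_dlt; apply: ler_wpM2r; first exact: ltW.
    by rewrite ler_nat (leq_trans (ltnW il)).
  by rewrite J_dlt; lra.
have H := hit_sum_exit aub (pt_neq a2) (pt_neq b2) nV (ltW dlt_gt0) slow late.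
split.
- exact: pr_before_gt0.
- have : 0 < pr (pt u) (before (pt a) (pt b)) by apply: pr_before_gt0; rewrite betweenC.
  by rewrite (pr_before_compl _ (pt_neq ab)) subr_gt0.
- by move: H; rewrite -/F mulrBr [_ * (F _ - _ - _)]mulrBr mulrBl mulrBr; lra.
- exact: (@pr_before_exit _ V _ _ _ aub (pt_neq' a1) (pt_neq' b1) nA).
Qed.

(** The points [x k] of a grid of equal scale, with lower bounds [l k], in units
    of [dlt], for the durations of the steps. *)
Variables (n : nat) (g : nat -> R) (l : nat -> nat).
Hypotheses (n_gt0 : (0 < n)%N) (g0 : g 0%N = 0) (gn : g n = 1).
Let D := (scale 1 - scale 0) / n%:R.
Hypothesis g_scale : forall k, (k <= n)%N -> scale (g k) = scale 0 + k%:R * D.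
Hypothesis g_itv : forall k, (k <= n)%N -> 0 <= g k <= 1.
Hypothesis g_lt : forall k, (k < n)%N -> g k < g k.+1.
Let x k := pt (g k).
Hypothesis half : 2^-1 <= pr (x 0%N) (hit V T0%:R).
Hypothesis l_slow : forall k, pr (x k) (hit (x k.+1) ((l k)%:R * dlt)) = 0.

Let D_gt0 : 0 < D.
Proof.
by rewrite divr_gt0 ?ltr0n// subr_gt0; apply: scale_lt; lra.
Qed.

Let g_gtN1 k : (k <= n)%N -> -1 < g k.
Proof. by move=> /g_itv/andP[+ _]; apply: lt_le_trans; rewrite ltrN10. Qed.

Let g_lt2 k : (k <= n)%N -> g k < 2.
Proof. by move=> /g_itv/andP[_ h]; apply: le_lt_trans h _; rewrite ltr1n. Qed.

Let halfx k : (k <= n)%N -> 2^-1 <= pr (x k) (hit V T0%:R).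
Proof.
elim: k => [//|k IH kn]; apply: le_trans (IH (ltnW kn)) _.
apply: pr_hit_through; rewrite between_pt; last by rewrite g_lt2// ltnW.
by rewrite g_lt// g_lt2.
Qed.

Let l_le k : (k < n)%N -> (l k <= T0 * M)%N.
Proof.
move=> kn; rewrite leqNgt; apply/negP => Tl.
suff : 2^-1 <= (0 : R) by rewrite leNgt invr_gt0 ltr0n.
apply: le_trans (halfx (ltnW kn)) _; rewrite -(l_slow k).
apply: pr_le; [exact: event_hit|exact: event_hit|].
move=> p cp p0 hV; have xkV : between (p 0) (x k.+1) V.
  by rewrite p0 between_pt ?g_lt ?g_lt2// ltnW.
have [s [sp sT /= ps]] := hV.
have [w [w0 ws pw]] := contpath_ivt cp (lexx 0) sp erefl ps xkV.
exists w; split => //; apply: lt_le_trans (lt_trans ws sT) _.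
by rewrite -T0_dlt; apply: ler_wpM2r; [exact: ltW|rewrite ler_nat ltnW].
Qed.

Let increment k := F (x k.+1) - F (x k).

(** At the first grid point any point behind serves as the other exit, since
    [F] increases. *)
Lemma increment0 : (l 0%N)%:R * 2^-1 <= increment 0%N.
Proof.
have h1 : -1 < - 2^-1 :> R by rewrite ltrN2 invf_lt1// ltr1n.
have h2 : - 2^-1 < g 0%N by rewrite g0 oppr_lt0 invr_gt0.
have [p [p0 p1 H _]] := hit_sum_exit_pt h1 h2 (g_lt n_gt0) (g_lt2 n_gt0)
  (l_slow 0%N) (l_le n_gt0) (halfx n_gt0).
have Fa : F (pt (- 2^-1)) <= F (pt (g 0%N)).
  by apply: F_mono => //; exact: g_lt2.
rewrite -subr_ge0 -(pmulr_rge0 _ p0); apply: le_trans H.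
by apply: mulr_ge0; rewrite subr_ge0// ltW.
Qed.

(** The up-going weight is at most one half on a grid of equal scale. *)
Lemma incrementS k : (k.+1 < n)%N -> 0 <= increment k ->
  increment k + (l k.+1)%:R * 2^-1 <= increment k.+1.
Proof.
move=> kn d0.
have [p [p0 p1 H Hs]] := hit_sum_exit_pt (g_gtN1 (ltnW (ltnW kn))) (g_lt (ltnW kn))
  (g_lt kn) (g_lt2 kn) (l_slow k.+1) (l_le kn) (halfx kn).
have p12 : p <= 1 - p.
  move: Hs; rewrite (g_scale kn) (g_scale (ltnW kn)) (g_scale (ltnW (ltnW kn))).
  by rewrite -!natr1; exact: weight_le_half D_gt0.
rewrite -lerBrDr -(ler_pM2l p0); apply: le_trans H.
exact: ler_wpM2r.
Qed.

Lemma increment_ge k : (k < n)%N ->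
  (\sum_(0 <= j < k.+1) (l j)%:R) * 2^-1 <= increment k.
Proof.
elim: k => [_|k IH kn]; first by rewrite big_nat1; exact: increment0.
have {}IH := IH (ltnW kn).
have -> : \sum_(0 <= j < k.+2) (l j)%:R = \sum_(0 <= j < k.+1) (l j)%:R + (l k.+1)%:R :> R.
  by rewrite big_nat_recr.
rewrite mulrDl; apply: le_trans (incrementS kn _); first by rewrite lerD2r.
by apply: le_trans IH; apply: mulr_ge0; [exact: sumr_ge0|rewrite invr_ge0].
Qed.

(** Beyond [v] there is room for one long step, to the point at [3/2], on which
    [F] rises by at most [J]. By convexity the last short step rises by a
    proportional amount. *)
Lemma last_increment : increment n.-1 * (scale (3 / 2) - scale 1) <= D * J%:R.
Proof.
have n1 : (n.-1 < n)%N by rewrite prednK.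
have gk : g n.-1 < 1 by rewrite -gn -[in g n](prednK n_gt0); exact: g_lt.
have h1 : 1 < 3 / 2 :> R by rewrite ltr_pdivlMr// mul1r ltr_nat.
have h2 : 3 / 2 < 2 :> R by rewrite ltr_pdivrMr// -natrM ltr_nat.
have hb : 2^-1 <= pr (pt (3 / 2)) (hit V T0%:R).
  apply: le_trans (halfx (leqnn n)) _; rewrite /x gn; apply: pr_hit_through.
  by rewrite between_pt ?h1 ?h2// (lt_trans h1).
have slow0 : pr (pt 1) (hit (pt (3 / 2)) (0%:R * dlt)) = 0 by rewrite mul0r pr_hit_le0.
have [p [p0 p1]] :=
  hit_sum_exit_pt (g_gtN1 (leq_pred n)) gk h1 h2 slow0 (leq0n _) hb.
rewrite mul0r subr0 (g_scale (leq_pred n)).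
have -> : n.-1%:R * D = scale 1 - scale 0 - D.
  have -> : n.-1%:R = n%:R - 1 :> R by rewrite -[in RHS](prednK n_gt0) -natr1 addrK.
  by rewrite mulrBl mul1r /D mulrC divfK// pnatr_eq0 -lt0n.
have Fle : F (pt (3 / 2)) <= J%:R by exact: hit_sum_le.
have F1 : 0 <= F (pt 1) by exact: hit_sum_ge0.
have F2 : F (pt 1) <= F (pt (3 / 2)) by exact: F_mono.
have s1W : scale 1 < scale (3 / 2).
  by apply: scale_lt => //; rewrite (lt_trans (ltrN10 _)).
rewrite /increment prednK// /x gn => H Hs.
apply: last_increment_bound p0 p1 (ltW D_gt0) _ _ _ H _.
- by rewrite subr_ge0 ltW.
- by rewrite subr_ge0.
- by apply: le_trans Fle; rewrite gerBl.
- exact: overshoot_weight Hs.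
Qed.

Lemma slow_sum_le :
  (\sum_(0 <= k < n) (l k)%:R) * dlt * (scale (3 / 2) - scale 1) * n%:R <= 4 * T0%:R.
Proof.
have := @increment_ge n.-1; rewrite prednK// => /(_ (leqnn _)).
have nR : 0 < n%:R :> R by rewrite ltr0n.
have s1W : scale 1 < scale (3 / 2) by apply: scale_lt; lra.
have Dn : D * n%:R <= 1.
  rewrite /D divfK ?gt_eqF//.
  have : scale 1 <= 1 by apply: pr_le1; exact: event_before.
  have : 0 < scale 0 by apply: scale_gt0; lra.
  by lra.
rewrite -subr_gt0 in s1W.
by have := slow_sum_bound nR s1W Dn (ler0n _ T0) dlt_gt0 J_dlt last_increment; exact.
Qed.

End speed_limit.

(** If the passage from [y] to [v] takes at least [eta], the number of steps of
    a grid is bounded, independently of the mesh [1 / M] of the lattice of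
    times, once this mesh is small compared with [eta / n]. *)
Lemma grid_bound (n T0 M : nat) (eta : R) : (0 < n)%N -> (0 < M)%N ->
  pr y (hit v eta) = 0 -> 2^-1 <= pr y (hit (pt 2) T0%:R) ->
  n%:R / M%:R <= eta / 2 ->
  n%:R * ((scale (3 / 2) - scale 1) * eta) <= 8 * T0%:R.
Proof.
move=> n0 M0 slow half nM.
have [g [g0 gn gs g01 gS]] := scale_grid n0.
pose x k := pt (g k).
have x0 : x 0%N = y by rewrite /x g0 /pt mul0r addr0.
have xn : x n = v by rewrite /x gn /pt mul1r subrKC.
have /choice[l lP] : forall k, exists l : nat,
    pr (x k) (hit (x k.+1) (l%:R / M%:R)) = 0 /\ 0 < pr (x k) (hit (x k.+1) (l.+1%:R / M%:R)).
  by move=> k; apply: slow_lattice; rewrite invr_gt0 ltr0n.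
have sum_l : eta / 2 <= (\sum_(0 <= k < n) (l k)%:R) / M%:R.
  have : eta < \sum_(0 <= k < n) ((l k).+1%:R / M%:R).
    rewrite ltNge; apply/negP => le_eta.
    have := @pr_hit_chainn x (fun k => (l k).+1%:R / M%:R) n.-1.
    rewrite prednK// x0 xn => /(_ (fun k _ => (lP k).2)).
    by move=> /lt_le_trans/(_ (pr_hit_mono y v le_eta)); rewrite slow ltxx.
  rewrite -mulr_suml.
  have -> : \sum_(0 <= k < n) (l k).+1%:R = \sum_(0 <= k < n) (l k)%:R + n%:R :> R.
    rewrite -[X in _ + X%:R](subn0 n) -sumr_const_nat -big_split/=.
    by apply: eq_bigr => j _; rewrite -natr1.
  by rewrite mulrDl; move: nM; lra.
have halfx : 2^-1 <= pr (pt (g 0%N)) (hit (pt 2) T0%:R) by rewrite -/(x 0%N) x0.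
have := slow_sum_le M0 n0 g0 gn gs g01 gS halfx (fun k => (lP k).1).
have s1W : scale 1 < scale (3 / 2) by apply: scale_lt; lra.
have nR : 0 < n%:R :> R by rewrite ltr0n.
rewrite -subr_gt0 in s1W; have := ler_wpM2r (ltW (mulr_gt0 s1W nR)) sum_l.
by lra.
Qed.

Lemma pr_hit_gt0 (eta : R) : 0 < eta -> 0 < pr y (hit v eta).
Proof.
move=> eta0; rewrite lt_neqAle pr_ge0 andbT; apply/eqP => /esym slow.
have s1W : scale 1 < scale (3 / 2) by apply: scale_lt; lra.
have h0 : 0 < (2^-1 : R) by [].
have [m nm] := pr_hit_large y (pt 2) h0.
have half : 2^-1 <= pr y (hit (pt 2) m.+1%:R) by lra.
pose c := (scale (3 / 2) - scale 1) * eta.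
have c0 : 0 < c by rewrite mulr_gt0// subr_gt0.
(* [n] violates the bound of [grid_bound], with [M] making [n / M] small enough *)
pose n := (Num.truncn (8 * m.+1%:R / c)).+1.
pose M := (Num.truncn (n%:R / (eta / 2))).+1.
have e2 : 0 < eta / 2 by rewrite divr_gt0.
have nM : n%:R / M%:R <= eta / 2.
  by rewrite ler_pdivrMr ?ltr0n// mulrC -ler_pdivrMr//; exact/ltW/truncnS_gt.
have := @grid_bound n m.+1 M eta isT isT slow half nM.
by rewrite -/c -ler_pdivlMr// leNgt truncnS_gt.
Qed.

End scale.

Definition hits_first x F (t : R) p := exists q : rat,
  [/\ (ratr q : R) <= t, hit x (ratr q) p & ~ hits (fun=> F) (ratr q) p].

Lemma hits_first_observable x F t : closed F ->
  observable `[0, +oo[%classic (hits_first x F t).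
Proof.
move=> cF; apply: observable_exists_rat => q.
apply: (@observable_ext _ _ (((fun=> (ratr q : R) <= t) : set (R -> R)) `&`
   (hit x (ratr q) `&` ~` hits (fun=> F) (ratr q)))).
  apply: observableI; first exact: observable_prop.
  apply: observableI; first exact: hit_observable_oo.
  by apply: observableC; apply: hits_observable_oo; exact: barrier_cst.
by move=> p _; split => [[? []]|[]].
Qed.

(** If a passage from [y] to [v] before the time [eta] always went through [l],
    then it would contain a fresh passage from [y] to [v], and its probability
    would be multiplied by that of visiting [l] before [v], which is less than
    one. *)
Lemma pr_hits_first_pt_gt0 l y v (eta : R) : between l y v -> 0 < eta ->
  0 < pr y (hits_first v [set l] eta).
Proof.
move=> lyv eta0.
have yv : y <> v by move=> E; move: lyv => /betweenP; rewrite E ltxx; lra.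
have lv : l <> v by move=> E; move: lyv => /betweenP; rewrite E; lra.
have A0 := pr_hit_gt0 yv eta0.
have b0 := pr_before_gt0 lyv.
have mW : event (hits_first v [set l] eta) by apply: event_observable; apply: hits_first_observable; exact: closed_eq.
pose C := before l v `&` reach l `&` [set p | hit v eta (shift l p)].
have mC : event C.
  apply: eventI; first by apply: event_known_at; exact: known_at_before.
  by apply: event_shift; exact: hit_observable_oo.
have pC : pr y C <= (1 - pr y (before v l)) * pr y (hit v eta).
  rewrite strong_markov_hit; [|exact: known_at_before|exact: hit_observable_oo].
  rewrite pr_reachI; last exact: event_before.
  rewrite (pr_before_compl _ lv).
  apply: ler_wpM2l; last exact: pr_hit_through.
  by rewrite subr_ge0; apply: pr_le1; exact: event_before.
have : pr y (hit v eta) <= pr y (hits_first v [set l] eta) + pr y C.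
  apply: le_trans (prU_le _ mW mC); apply: pr_le; [exact: event_hit|exact: eventU|].
  move=> p cp p0 hv.
  have [bl|nbl] := pselect (before l v p).
    right; split; first by split => //; exact: before_reach bl.
    have [u [u0 ut /= pu]] := hv; apply/hit_shift; exists u; split => //; last first.
      by apply: lt_le_trans ut _; rewrite lerDr first_ge0.
    rewrite ltNge; apply/negP => ul; exact: (before_avoids bl u0 ul).
  left; have fe := first_lt_hit hv; have rv := hit_reach hv.
  have bvl : before v l p.
    have [rl|nl] := pselect (reach l p); last first.
      by apply: (beforeP hv); apply: contra_not nl; exact: hit_reach.
    apply: beforeI => //.
      by rewrite p0 => E; move: lyv => /betweenP; rewrite E ltxx; lra.
    move=> u u0 uf pu; apply: nbl; apply: (@beforeP _ _ (first v p)).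
      exists u; split => //; rewrite lt_neqAle uf andbT; apply/eqP => E.
      by apply: lv; rewrite -pu E first_val.
    by move=> /first_lt_hit; rewrite ltxx.
  have [q [hq nq]] := bvl.
  have /rat_in_itvoo[r] : first v p < Num.min (ratr q) eta.
    by rewrite lt_min fe (first_lt_hit hq).
  rewrite in_itv/= lt_min => /and3P[r1 r2 r3]; exists r; split.
  - exact: ltW.
  - exact/first_lt.
  - by apply: contra_not nq; apply: hitsW; exact: ltW.
by nra.
Qed.

(** * Two barriers embedding the same law *)

Lemma event_entry_point D (M : set (measurableTypeR R)) : barrier D -> measurable M ->
  event [set p | M (entry_point D p)].
Proof.
move=> bD mM; rewrite /event -[S in measurable S]setTI.
by apply: (X_at_measurable (tau := fun w => entry_instant D (path w))) => // [w|];
  [exact: entry_instant_ge0|exact: entry_instant_measurable].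
Qed.

Lemma event_entered D : barrier D -> event (entered D).
Proof. exact: entered_measurable. Qed.

Lemma event_entry_instant_gt0 D : barrier D -> event [set p | 0 < entry_instant D p].
Proof.
move=> bD; rewrite /event -[S in measurable S]setTI.
have := entry_instant_measurable bD measurableT (measurable_itv `]0, +oo[).
by congr measurable; apply/seteqP; split => w /=; rewrite in_itv/= andbT.
Qed.

Section uniqueness.
Variable mu : probability (measurableTypeR R) R.
Hypothesis mu0 : mu [set 0] = 0%E.
Let m (M : set (measurableTypeR R)) : R := fine (mu M).

Section one.
Variable D : R -> set R.
Hypothesis bD : barrier D.
Hypothesis eD : embeds (P 0) X (entry_time X D) mu.

Lemma pr_entry_point (M : set (measurableTypeR R)) : measurable M ->
  pr 0 [set p | M (entry_point D p)] = m M.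
Proof. by move=> mM; have := eD.2 M mM; rewrite /pr /m => <-. Qed.

Lemma pr_entered : pr 0 (entered D) = 1.
Proof.
have [N [mN N0 DN]] := eD.1.
have me := event_entered bD.
have : pr 0 (~` entered D) = 0; last by rewrite prC//; lra.
have : (P 0 (ev (~` entered D)) <= P 0 N)%E.
  apply: le_measure; rewrite ?inE//; first exact: eventC.
  by move=> w nw; apply: DN => /= /(entry_lty D (path w)).
rewrite N0 prE; last exact: eventC.
by rewrite lee_fin => h; apply/eqP; rewrite eq_le h pr_ge0.
Qed.

(** An entry at time 0 takes place at the starting point 0, which mu does not
    charge. *)
Lemma pr_entry_instant_gt0 : pr 0 [set p | 0 < entry_instant D p] = 1.
Proof.
have mt := event_entry_instant_gt0 bD.
have m0 := measurable_set1 (0 : R).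
have : pr 0 (~` [set p | 0 < entry_instant D p]) <= pr 0 [set p | [set 0] (entry_point D p)].
  apply: pr_le; [exact: eventC|exact: event_entry_point|].
  move=> p cp p0 /= /negP; rewrite -leNgt => t0.
  have /eqP E : entry_instant D p == 0 by rewrite eq_le t0 entry_instant_ge0.
  by rewrite /entry_point E.
rewrite (pr_entry_point m0) /m mu0/=.
rewrite prC// => h; apply/eqP; rewrite eq_le pr_le1//=; lra.
Qed.

Definition proper p := entered D p /\ 0 < entry_instant D p.

Lemma event_proper : event proper.
Proof. by apply: eventI; [exact: event_entered|exact: event_entry_instant_gt0]. Qed.


End one.

Section two.
Variables D1 D2 : R -> set R.
Hypotheses (bD1 : barrier D1) (bD2 : barrier D2).
Hypotheses (eD1 : embeds (P 0) X (entry_time X D1) mu)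
           (eD2 : embeds (P 0) X (entry_time X D2) mu).

Let good := proper D1 `&` proper D2.

Let mgood : event good.
Proof. by apply: eventI; exact: event_proper. Qed.

Lemma pr_good A : event A -> pr 0 (A `&` good) = pr 0 A.
Proof.
move=> mA.
have key B C : event B -> event C -> pr 0 C = 1 -> pr 0 (B `&` C) = pr 0 B.
  move=> mB mC C1; apply/eqP; rewrite eq_le pr_le//=; [|exact: eventI|by move=> ? _ _ []].
  have := prU_le 0 (eventI mB mC) (eventC mC).
  rewrite prC// C1 subrr addr0; apply: le_trans.
  apply: pr_le => //; first by apply: eventU; [exact: eventI|exact: eventC].
  by move=> p _ _ Bp; have [?|?] := pselect (C p); [left|right].
rewrite /good /proper /= -!setIA.
rewrite (_ : A `&` _ = A `&` entered D1 `&` [set p | 0 < entry_instant D1 p] `&` entered D2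
     `&` [set p | 0 < entry_instant D2 p]); last by apply/seteqP; split => p /=; rewrite /proper /=; tauto.
have mE1 := event_entered bD1; have mE2 := event_entered bD2.
have mT1 := event_entry_instant_gt0 bD1; have mT2 := event_entry_instant_gt0 bD2.
rewrite key; [|exact: (eventI (eventI (eventI mA mE1) mT1) mE2)|exact: mT2|exact: pr_entry_instant_gt0].
rewrite key; [|exact: (eventI (eventI mA mE1) mT1)|exact: mE2|exact: pr_entered].
rewrite key; [|exact: (eventI mA mE1)|exact: mT1|exact: pr_entry_instant_gt0].
by rewrite key//; exact: pr_entered.
Qed.

Let E21 := earlier D2 D1.

Let mE21 : event E21.
Proof. by apply: event_observable; exact: earlier_observable. Qed.

(** The levels over which [D1] lasts at least as long as [D2]. *)
Let dom := [set x : R | forall t, 0 < t -> D2 t x -> D1 t x].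

Let mdom : measurable (dom : set (measurableTypeR R)).
Proof.
apply: (@measurable_ext _ _ [set x | forall q : rat, 0 < (ratr q : R) -> D2 (ratr q) x -> D1 (ratr q) x]).
  apply: (@measurable_forall _ _ (measurableTypeR R)) => q.
  have [q0|q0] := ltP 0 (ratr q : R); last first.
    by apply: measurable_ext measurableT _ => x; split.
  apply: (@measurable_ext _ _ (~` D2 (ratr q) `|` D1 (ratr q))).
    by apply: measurableU; [apply: measurableC|]; apply: closed_measurable;
      exact: barrier_closed.
  move=> x; split => [[//|]//|]; move=> /(_ isT) h.
  by have [?|?] := pselect (D2 (ratr q) x); [right; exact: h|left].
move=> x; split=> [H t t0 D2t|H q q0]; last exact: H.
apply: contrapT => nD1.
have [s [s0 st nDs]] : exists s, [/\ 0 < s, s < t & ~ D1 s x].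
  apply: contrapT => H'; apply: nD1; apply: (barrier_left bD1) => // s s0 st.
  by apply: contrapT => nDs; apply: H'; exists s.
have /rat_in_itvoo[q] := st; rewrite in_itv/= => /andP[sq qt].
have q0 : 0 < (ratr q : R) by exact: lt_trans sq.
apply: nDs; apply: (barrier_antitone bD1 s0 (ltW sq)); apply: H => //.
exact: (barrier_antitone bD2 q0 (ltW qt)).
Qed.

(** This is the event that [X_tau] is in [M], for the smaller tau of the two
    entry times. *)
Let atmin (M : set (measurableTypeR R)) :=
  (E21 `&` [set p | M (entry_point D2 p)]) `|` (~` E21 `&` [set p | M (entry_point D1 p)]).

Let matmin M : measurable M -> event (atmin M).
Proof.
by move=> mM; apply: eventU; apply: eventI => //; [exact: event_entry_point|exact: eventC|exact: event_entry_point].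
Qed.

(** If the position at the first entry is in [dom], then this is an entry into
    [D1]; if not, it is an entry into [D2]. Thus the law of this position is
    at most mu on [dom] and on its complement. *)
Lemma atmin_le M : measurable M -> pr 0 (atmin M) <= m M.
Proof.
move=> mM; have mMd := measurableI _ _ mM mdom; have mMn := measurableD mM mdom.
have -> : m M = m (M `&` dom) + m (M `\` dom).
  rewrite /m -fineD ?fin_num_measure// -measureU//.
    by rewrite setUIDK.
  by rewrite setDE setIACA setICr setI0.
rewrite -(pr_entry_point eD1 mMd) -(pr_entry_point eD2 mMn).
have m1 := event_entry_point bD1 mMd; have m2 := event_entry_point bD2 mMn.
apply: le_trans (prU_le 0 m1 m2); rewrite -(pr_good (matmin mM)).
apply: pr_le; [exact: eventI (matmin mM) mgood|exact: eventU|].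
move=> p cp p0 [H [[r1 t1] [r2 t2]]].
have a1 := entry_instant_attained bD1 cp r1 t1.
have a2 := entry_instant_attained bD2 cp r2 t2.
case: H => -[h Mp].
  right; split => // dm; have := dm _ t2 a2; move=> /(entry_instant_le_entry_point t2).
  by rewrite leNgt (earlier_lt r1 h).
have t12 : entry_instant D1 p <= entry_instant D2 p.
  by rewrite leNgt; apply/negP => /(lt_earlier r2).
have [dm|ndm] := pselect (dom (entry_point D1 p)); first by left.
right; suff E : entry_point D2 p = entry_point D1 p by rewrite /= E.
rewrite /entry_point; congr p; apply/eqP; rewrite eq_le t12 andbT.
apply: (entry_instant_le_entry_point t1).
move: ndm => /existsNP[t /not_implyP[t0 /not_implyP[D2t nD1t]]].
have t1t : entry_instant D1 p < t.
  rewrite ltNge; apply/negP => tt; apply: nD1t.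
  exact: (barrier_antitone bD1 t0 tt).
exact: (barrier_antitone bD2 t1 (ltW t1t)).
Qed.

(** The gap [K q] of [D1] at a rational time [q] contains the position at the
    first of the two entries whenever it contains the position at the entry
    into [D1]. By [atmin_le] the converse holds almost surely: the exceptional
    event [Z q] is null. An earlier entry into [D2] puts the path in [Z q] for
    some [q]. *)
Lemma pr_earlier0 : pr 0 E21 = 0.
Proof.
pose K (q : rat) : set (measurableTypeR R) := ~` D1 (ratr q).
pose Z (q : rat) := ((fun=> 0 < (ratr q : R)) : set (R -> R)) `&`
   (atmin (K q) `&` ~` [set p | K q (entry_point D1 p)]).
have mK q : 0 < (ratr q : R) -> measurable (K q).
  by move=> q0; apply: measurableC; apply: closed_measurable; exact: barrier_closed.
have mZ' q : 0 < (ratr q : R) -> event (atmin (K q) `&` ~` [set p | K q (entry_point D1 p)]).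
  by move=> q0; exact: eventI (matmin (mK q q0)) (eventC (event_entry_point bD1 (mK q q0))).
have mZ q : event (Z q).
  have [q0|q0] := ltP 0 (ratr q : R).
    by apply: measurable_ext (mZ' q q0) _ => w; rewrite /Z/= q0; split => [|[]].
  apply: measurable_ext measurable0 _ => w; split => // -[/= q1].
  by have := lt_le_trans q1 q0; rewrite ltxx.
have Z0 q : pr 0 (Z q) <= 0.
  have [q0|q0] := ltP 0 (ratr q : R); last first.
    rewrite pr_null//= => p _ _ [/= q1].
    by have := lt_le_trans q1 q0; rewrite ltxx.
  have mk := mK q q0; have ma := matmin mk; have me := event_entry_point bD1 mk.
  have incl : pr 0 [set p | K q (entry_point D1 p)] <= pr 0 (atmin (K q) `&` [set p | K q (entry_point D1 p)]).
    rewrite -(pr_good me); apply: pr_le; [exact: eventI|exact: eventI|].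
    move=> p cp p0 [Kp [[r1 t1] [r2 t2]]]; split => //.
    have a1 := entry_instant_attained bD1 cp r1 t1.
    have a2 := entry_instant_attained bD2 cp r2 t2.
    have [h|nh] := pselect (E21 p); last by right.
    left; split => // D1q.
    have t21 := earlier_lt r1 h.
    have tq : entry_instant D1 p < ratr q.
      by rewrite ltNge; apply/negP => qt; apply: Kp; exact: (barrier_antitone bD1 q0 qt).
    have := barrier_antitone bD1 t2 (ltW (lt_trans t21 tq)) D1q.
    by move=> /(entry_instant_le_entry_point t2); rewrite leNgt t21.
  have lemu := atmin_le mk; rewrite -(pr_entry_point eD1 mk) in lemu.
  have := prU 0 (eventI ma me) (eventI ma (eventC me)) (fun p _ a b => b.2 a.2).
  rewrite -setIUr setUv setIT => E.
  have : pr 0 (Z q) <= pr 0 (atmin (K q) `&` ~` [set p | K q (entry_point D1 p)]).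
    by apply: pr_le => //; [exact: mZ'|move=> p _ _ []].
  by lra.
pose Zn n := if unpickle n is Some q then Z q else set0.
have mZn n : event (Zn n) by rewrite /Zn; case: unpickle => [q|]; [exact: mZ|exact: measurable0].
apply/eqP; rewrite eq_le pr_ge0 andbT -(pr_good mE21) leNgt; apply/negP => E0.
have [|n] := @pr_bigcup_pos 0 Zn mZn; last first.
  by rewrite /Zn; case: unpickle => [q|]; [rewrite ltNge Z0|rewrite pr0 ltxx].
apply: (lt_le_trans E0); apply: pr_le; [exact: eventI|exact: event_bigcup|].
move=> p cp p0 [h [[r1 t1] [r2 t2]]].
have a1 := entry_instant_attained bD1 cp r1 t1.
have a2 := entry_instant_attained bD2 cp r2 t2.
have t21 := earlier_lt r1 h.
have nD : ~ D1 (entry_instant D2 p) (entry_point D2 p).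
  by move=> /(entry_instant_le_entry_point t2); rewrite leNgt t21.
have [s [s0 st nDs]] : exists s, [/\ 0 < s, s < entry_instant D2 p & ~ D1 s (entry_point D2 p)].
  apply: contrapT => H'; apply: nD; apply: (barrier_left bD1) => // s s0 st.
  by apply: contrapT => nDs; apply: H'; exists s.
have /rat_in_itvoo[q] := st; rewrite in_itv/= => /andP[sq qt].
have q0 : 0 < (ratr q : R) by exact: lt_trans sq.
exists (pickle q); rewrite /Zn pickleK; split => //; split.
  left; split => // D1q; apply: nDs; exact: (barrier_antitone bD1 s0 (ltW sq)).
move=> /=; apply; apply: (barrier_antitone bD1 q0 _ a1).
exact: ltW (lt_trans qt t21).
Qed.

End two.

(** * Equality of the barriers *)

Lemma barrierU D1 D2 : barrier D1 -> barrier D2 -> barrier (fun t => D1 t `|` D2 t).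
Proof.
move=> b1 b2; split.
- by move=> t t0; apply: closedU; exact: barrier_closed.
- move=> s t s0 st x [h|h]; [left; exact: (barrier_antitone b1 s0 st)|].
  by right; exact: (barrier_antitone b2 s0 st).
- move=> t x t0 H; have [h1|] := pselect (forall s, 0 < s -> s < t -> D1 s x).
    by left; apply: (barrier_left b1).
  move=> /existsNP[s /not_implyP[s0 /not_implyP[st nDs]]].
  right; apply: (barrier_left b2) => // u u0 ut.
  have m0 : 0 < Num.max s u by rewrite lt_max s0.
  have mt : Num.max s u < t by rewrite gt_max st.
  case: (H _ m0 mt) => [h|].
    by case: nDs; apply: (barrier_antitone b1 s0 _ h); rewrite le_max lexx.
  by apply: (barrier_antitone b2 u0); rewrite le_max lexx orbT.
Qed.

(** Including the time [t] makes survival up to [t] an event of the past of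
    [t] after which the path is in the gap at time [t]. *)
Definition hits_by D t p := hits D t p \/ D t (p t).

Lemma hits_by_observable D t : barrier D -> 0 < t -> observable `[0, t]%classic (hits_by D t).
Proof.
move=> bD t0; apply: observableU; first exact: hits_observable.
apply: observable_coord; first by rewrite /= in_itv/= ltW//= lexx.
by apply: closed_measurable; exact: barrier_closed.
Qed.

Lemma event_hits_by D t : barrier D -> 0 < t -> event (hits_by D t).
Proof. by move=> bD t0; exact: event_observable (observable_oo (hits_by_observable bD t0)). Qed.

Lemma hits_byP D u t p : 0 < u -> u <= t -> D u (p u) -> hits_by D t p.
Proof.
move=> u0; rewrite le_eqVlt => /predU1P[->|ut]; first by right.
by left; exists u.
Qed.

Lemma pr_survive_start D1 D2 (r : R) : barrier D1 -> barrier D2 ->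
  embeds (P 0) X (entry_time X D1) mu -> embeds (P 0) X (entry_time X D2) mu ->
  0 < r -> exists e : R, [/\ 0 < e, e < r &
    0 < pr 0 (~` hits_by (fun t => D1 t `|` D2 t) e)].
Proof.
move=> b1 b2 e1 e2 r0; have bD := barrierU b1 b2; set D := (fun t => _) in bD *.
pose A n := ~` hits D n.+1%:R^-1.
have mA n : event (A n) by apply: eventC; apply: event_observable; exact: hits_observable_oo.
have [|n n0] := @pr_bigcup_pos 0 A mA.
  have mg : event (proper D1 `&` proper D2) by apply: eventI; exact: event_proper.
  apply: (@lt_le_trans _ _ (pr 0 (setT `&` (proper D1 `&` proper D2)))).
    by rewrite pr_good// ?prT//; exact: eventT.
  apply: pr_le; [exact: eventI eventT mg|exact: event_bigcup|].
  move=> p cp p0 [_ [[_ t1] [_ t2]]].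
  have [n nP] : exists n : nat, n.+1%:R^-1 < Num.min (entry_instant D1 p) (entry_instant D2 p).
    by apply: small_invS; rewrite lt_min t1.
  exists n => -[u [u0 un Du]]; move: nP; rewrite lt_min => /andP[n1 n2].
  case: Du => Du.
    by have := lt_trans un n1; rewrite ltNge (@entry_instant_le _ D1 _ _ u0 Du).
  by have := lt_trans un n2; rewrite ltNge (@entry_instant_le _ D2 _ _ u0 Du).
have m0 : 0 < Num.min n.+1%:R^-1 r by rewrite lt_min r0 invr_gt0 ltr0n.
exists (Num.min n.+1%:R^-1 r / 2); split.
- by rewrite divr_gt0.
- apply: (@lt_le_trans _ _ (Num.min n.+1%:R^-1 r)); last by rewrite ge_min lexx orbT.
  by rewrite ltr_pdivrMr// ltr_pMr// ltr1n.
set e := _ / 2; have e0 : 0 < e by rewrite divr_gt0.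
have en : e < n.+1%:R^-1.
  apply: (@lt_le_trans _ _ (Num.min n.+1%:R^-1 r)); last by rewrite ge_min lexx.
  by rewrite ltr_pdivrMr// ltr_pMr// ltr1n.
apply: (lt_le_trans n0); apply: pr_le => //; first by apply: eventC; exact: event_hits_by.
move=> p cp p0; apply: contra_not => -[|De]; first by apply: hitsW; exact: ltW.
by exists e.
Qed.

(** Up to a small time [e] this holds because the entry times are positive. The
    gap at time [e] is open and remains in the later gaps, and one can remain
    in it from time [e] to time [r]. *)
Lemma pr_survive D1 D2 (r : R) : barrier D1 -> barrier D2 ->
  embeds (P 0) X (entry_time X D1) mu -> embeds (P 0) X (entry_time X D2) mu ->
  0 < r -> 0 < pr 0 (~` hits_by (fun t => D1 t `|` D2 t) r).
Proof.
move=> b1 b2 e1 e2 r0; have bD := barrierU b1 b2.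
have [e [e0 er A0]] := pr_survive_start b1 b2 e1 e2 r0.
set D := (fun t => _) in bD A0 *.
have cF : closed (D e) by exact: barrier_closed.
have oA : observable `[0, e]%classic (~` hits_by D e).
  by apply: observableC; exact: hits_by_observable.
(* at time [e] the path is in the gap, where it can stay for the duration [r] *)
have [|mB B0] := markov_pos (ltW e0) oA (stay_observable cF r) A0.
  by move=> p cp nh; apply: pr_stay_gt0 => // De; apply: nh; right.
apply: (lt_le_trans B0); apply: pr_le.
- by apply: eventI => //; apply: eventC; exact: event_hits_by.
- by apply: eventC; exact: event_hits_by.
move=> p cp p0 [nh ns].
have nu u : 0 < u -> u <= r -> ~ D u (p u).
  move=> u0 ur Du; have [ue|eu] := leP u e; first by apply: nh; exact: hits_byP Du.
  apply: ns; exists (u - e); split.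
  - by rewrite subr_gt0.
  - by lra.
  - by rewrite subrKC; exact: (barrier_antitone bD e0 (ltW eu)).
by move=> [[u [u0 ur Du]]|Dr]; [exact: (nu u u0 (ltW ur))|exact: (nu r r0)].
Qed.

Lemma earlier_of_first x F p : contpath p -> closed F -> ~ F (p 0) -> ~ F x ->
  reach x p -> (forall u, 0 < u -> u <= first x p -> ~ F (p u)) ->
  earlier (fun=> [set x]) (fun=> F) p.
Proof.
move=> cp cF F0 Fx rx nF; have bF := barrier_cst cF.
have [eF|nF'] := pselect (entered (fun=> F) p); last first.
  have [t ht] := rx; apply: (@earlierP _ _ _ t) => //.
  by apply: contra_not nF' => h; exists t.
have t0 : 0 < entry_instant (fun=> F) p.
  rewrite lt_neqAle entry_instant_ge0 andbT; apply/eqP => E.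
  have /nbhs_ballP[e /= e0 eP] : nbhs (p 0) (~` F).
    by apply: open_nbhs_nbhs; split => //; exact: closed_openC.
  have [d' d0 dP] := contpath_eps cp (lexx 0) e0.
  have /(entry_instant_lt d' eF)[u [u0 ud Fu]] : entry_instant (fun=> F) p < d' by rewrite -E.
  apply: (eP (p u)) Fu; rewrite /ball/= distrC; apply: dP; first exact: ltW.
  by rewrite subr0 gtr0_norm.
have aF := entry_instant_attained bF cp eF t0.
apply: lt_earlier => //; rewrite ltNge; apply/negP => h.
exact: (nF (entry_instant (fun=> F) p)).
Qed.

(** A point [l] slightly behind [y], as seen from [x]. *)
Lemma between_open_side y x (U : set R) : open U -> U y -> y <> x ->
  exists l, between l y x /\ forall w, between l w x -> U w \/ between y w x.
Proof.
move=> oU Uy yx; have /nbhs_ballP[e /= e0 eP] : nbhs y U by exact: open_nbhs_nbhs.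
have Uw w : y - e < w -> w < y + e -> U w.
  by move=> h1 h2; apply: eP; rewrite /ball/= ltr_distl; apply/andP; split; lra.
have [yx'|xy] : y < x \/ x < y by case: (ltgtP y x) => // _; [left|right].
- exists (y - e / 2); split; first by apply/betweenP; left; lra.
  move=> w /betweenP[|] /andP[h1 h2]; last lra.
  have [wy|yw] := leP w y; first by left; apply: Uw; lra.
  by right; apply/betweenP; left; rewrite yw.
- exists (y + e / 2); split; first by apply/betweenP; right; lra.
  move=> w /betweenP[|] /andP[h1 h2]; first lra.
  have [wy|yw] := ltP w y; last by left; apply: Uw; lra.
  by right; apply/betweenP; right; rewrite h1.
Qed.

(** A fast passage to [x] that does not go back beyond a point [l] close to
    [y] stays between [l] and [x]. *)
Lemma pr_hits_first_gt0 y x F (t : R) : closed F -> y <> x -> ~ F y -> ~ F x ->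
  (forall w, between y w x -> ~ F w) -> 0 < t -> 0 < pr y (hits_first x F t).
Proof.
move=> cF yx Fy Fx Fyx t0.
have oF : open (~` F) by exact: closed_openC.
have [l [lyx lU]] := between_open_side oF Fy yx.
have lF w : between l w x -> ~ F w by move=> /lU[|/Fyx].
apply: (lt_le_trans (pr_hits_first_pt_gt0 lyx t0)); apply: pr_le.
- by apply: event_observable; apply: hits_first_observable; exact: closed_eq.
- by apply: event_observable; exact: hits_first_observable.
move=> p cp p0 [q [qt hx nl]].
have bx : before x l p by exists q.
have rx := before_reach bx.
have [q' [h1 h2]] : earlier (fun=> [set x]) (fun=> F) p.
  apply: earlier_of_first => //; first by rewrite p0.
  move=> u u0 ux; have [] := before_between cp _ bx u0 ux; first by rewrite p0.
    exact: lF.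
  by move=> ->.
have : first x p < Num.min (ratr q) (ratr q').
  by rewrite lt_min (first_lt_hit hx) (first_lt_hit h1).
move=> /rat_in_itvoo[q2]; rewrite in_itv/= lt_min => /and3P[a1 a2 a3].
exists q2; split.
- by apply: le_trans (ltW a2) qt.
- exact/first_lt.
- by apply: contra_not h2; apply: hitsW; exact: ltW.
Qed.

Definition gap_convex D := forall t x y w, 0 < t -> ~ D t x -> ~ D t y ->
  between x w y -> ~ D t w.

Lemma barrier_sub D1 D2 : barrier D1 -> barrier D2 -> gap_convex D1 ->
  embeds (P 0) X (entry_time X D1) mu -> embeds (P 0) X (entry_time X D2) mu ->
  forall t, 0 < t -> D2 t `<=` D1 t.
Proof.
move=> b1 b2 cv e1 e2 t t0 x D2x; apply: contrapT => nD1.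
have [r [r0 rt nDr]] : exists r, [/\ 0 < r, r < t & ~ D1 r x].
  apply: contrapT => H; apply: nD1; apply: (barrier_left b1) => // s s0 st.
  by apply: contrapT => nDs; apply: H; exists s.
have bD := barrierU b1 b2; have A0 := pr_survive b1 b2 e1 e2 r0.
set D := (fun t => _) in bD A0.
have oA : observable `[0, r]%classic (~` hits_by D r).
  by apply: observableC; exact: hits_by_observable.
have cF : closed (D1 r) by exact: barrier_closed.
have tr0 : 0 < t - r by rewrite subr_gt0.
have D2r : D2 r x by exact: (barrier_antitone b2 r0 (ltW rt)).
(* survive until time [r], then reach [x] before time [t] within the gap at [r] *)
have [|mB B0] := markov_pos (ltW r0) oA (hits_first_observable x (t - r) cF) A0.
  move=> p cp nh; have nD : ~ D r (p r) by move=> Dr; apply: nh; right.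
  apply: pr_hits_first_gt0 => //.
  - by move=> E; apply: nD; right; rewrite E.
  - by move=> h; apply: nD; left.
  - by move=> w; apply: cv => // h; apply: nD; left.
have := pr_earlier0 b1 b2 e1 e2 => E0.
suff : 0 < pr 0 (earlier D2 D1) by rewrite E0 ltxx.
apply: (lt_le_trans B0); apply: pr_le.
- by apply: eventI => //; apply: eventC; exact: event_hits_by.
- by apply: event_observable; exact: earlier_observable.
move=> p cp p0 [nh [q [qt [s [s0 sq /= ps]] nF]]].
apply: (@earlierP _ _ _ (r + ratr q)).
  exists (r + s); split; [by rewrite addr_gt0|by rewrite ltrD2l|].
  by rewrite ps; apply: (barrier_antitone b2 _ _ D2x); [rewrite addr_gt0|lra].
move=> [u [u0 uq D1u]]; have [ur|ru] := leP u r.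
  by apply: nh; apply: (@hits_byP _ u) => //; left.
apply: nF; exists (u - r); split; [by rewrite subr_gt0|by lra|].
by rewrite subrKC; exact: (barrier_antitone b1 r0 (ltW ru)).
Qed.

Lemma barrier_unique D1 D2 : barrier D1 -> barrier D2 -> gap_convex D1 -> gap_convex D2 ->
  embeds (P 0) X (entry_time X D1) mu -> embeds (P 0) X (entry_time X D2) mu ->
  forall t, 0 < t -> D1 t = D2 t.
Proof.
by move=> b1 b2 c1 c2 e1 e2 t t0; apply/seteqP; split; exact: barrier_sub.
Qed.

(** The gap at time [t] contains the position of the surviving paths. *)
Lemma barrier_gap D : barrier D -> embeds (P 0) X (entry_time X D) mu ->
  forall t, 0 < t -> exists x, ~ D t x.
Proof.
move=> bD eD t t0; apply: contrapT => /forallNP H.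
have := pr_survive bD bD eD eD t0; rewrite pr_null ?ltxx//.
  by apply: eventC; apply: event_hits_by => //; exact: barrierU.
by move=> p _ _; apply; right; left; apply: contrapT; exact: H.
Qed.

End uniqueness.
End process.

(** * Boundaries as barriers *)
Section boundaries.
Context {R : realType}.
Implicit Types (b c : R -> \bar R).

Definition region b c (t : R) : set R := [set x | (b t <= x%:E)%E \/ (x%:E <= c t)%E].

Lemma left_limit (V : topologicalType) (f : R -> V) (t s0 : R) (U : set V) :
  left_continuous f -> 0 < t -> s0 < t -> open U -> U (f t) ->
  exists s, [/\ s0 < s, 0 < s, s < t & U (f s)].
Proof.
move=> lf t0 s0t oU Ut.
have m0 : Num.max s0 0 < t by rewrite gt_max s0t.
have : \forall s \near t^'-, U (f s) /\ Num.max s0 0 < s /\ s < t.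
  near=> s; split; last by split; near: s; [exact: nbhs_left_gt|exact: nbhs_left_lt].
  by near: s; apply: (lf t t0); apply: open_nbhs_nbhs.
move=> /(@filter_ex _ _ (at_left_proper_filter t))[s [Us [+ s3]]]; rewrite gt_max => /andP[s1 s2].
by exists s; split.
Unshelve. all: by end_near. Qed.

Lemma region_barrier b c : increasing_eboundary b -> decreasing_eboundary c ->
  barrier (region b c).
Proof.
move=> [_ bm bl] [_ cm cl].
have bmono s t : 0 < s -> s <= t -> (b s <= b t)%E.
  by move=> s0 st; apply: bm => //; rewrite in_itv/= andbT // (lt_le_trans s0 st).
have cmono s t : 0 < s -> s <= t -> (c t <= c s)%E.
  by move=> s0 st; apply: cm => //; rewrite in_itv/= andbT // (lt_le_trans s0 st).
split.
- move=> t t0; rewrite -[region b c t]setCK; apply: open_closedC.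
  rewrite (_ : ~` _ = [set x : R | (x%:E < b t)%E] `&` [set x : R | (c t < x%:E)%E]).
    by apply: openI; [exact: open_ereal_lt|exact: open_ereal_gt].
  apply/seteqP; split => x /=.
    move=> /not_orP[/negP h1 /negP h2]; move: h1 h2.
    by rewrite -!ltNge.
  by rewrite !ltNge => -[/negP h1 /negP h2] [].
- move=> s t s0 st x [h|h]; [left|right].
    exact: le_trans (bmono _ _ s0 st) h.
  exact: le_trans h (cmono _ _ s0 st).
- move=> t x t0 H; apply: contrapT => /not_orP[/negP + /negP].
  rewrite -!ltNge => xb cx.
  have [s1 [_ s10 s1t /= xb1]] := left_limit bl t0 t0 (@open_ereal_gt_ereal _ x%:E) xb.
  have [s2 [s12 s20 s2t /= cx2]] := left_limit cl t0 s1t (@open_ereal_lt_ereal _ x%:E) cx.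
  case: (H s2 s20 s2t); apply/negP; rewrite -ltNge//.
  exact: lt_le_trans xb1 (bmono _ _ s10 (ltW s12)).
Qed.

Lemma region_gapP b c t x : ~ region b c t x <-> (c t < x%:E < b t)%E.
Proof.
split; first by move=> /not_orP[/negP + /negP]; rewrite -!ltNge => -> ->.
by move=> /andP[cx xb] [|]; apply/negP; rewrite -ltNge.
Qed.

Lemma region_gap_convex b c : gap_convex (region b c).
Proof.
move=> t x y w _ /region_gapP/andP[cx xb] /region_gapP/andP[cy yb] /betweenP xwy.
apply/region_gapP; case: xwy => /andP[h1 h2]; apply/andP; split.
- by apply: lt_trans cx _; rewrite lte_fin.
- by apply: lt_trans yb; rewrite lte_fin.
- by apply: lt_trans cy _; rewrite lte_fin.
- by apply: lt_trans xb; rewrite lte_fin.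
Qed.

(** A gap that is not empty determines both of its end points. An empty one
    would not, when the boundaries have crossed. *)
Lemma region_le b1 c1 b2 c2 t : region b1 c1 t = region b2 c2 t ->
  (exists x, ~ region b1 c1 t x) -> (b2 t <= b1 t)%E /\ (c1 t <= c2 t)%E.
Proof.
move=> E [x nx]; have nx2 := nx; rewrite E in nx2.
move: nx nx2 => /region_gapP/andP[c1x xb1] /region_gapP/andP[c2x xb2].
split; rewrite leNgt; apply/negP => h.
  case b1E : (b1 t) h xb1 => [z| |] // h xz; last by move: h; rewrite ltNge leey.
  have : region b1 c1 t z by left; rewrite b1E.
  rewrite E => -[|]; apply/negP; rewrite -ltNge//.
  exact: lt_trans c2x xz.
case c1E : (c1 t) h c1x => [z| |] // h xz; last by move: h; rewrite ltNge leNye.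
have : region b1 c1 t z by right; rewrite c1E.
rewrite E => -[|]; apply/negP; rewrite -ltNge//.
exact: lt_trans xz xb2.
Qed.

Lemma increasing_eboundary_fin (b : R -> R) : increasing_boundary b ->
  increasing_eboundary (EFin \o b).
Proof.
move=> [bm bl]; split => // t t0 A.
exact: (bl t t0 (fun x => A x%:E)).
Qed.

Lemma decreasing_eboundary_fin (c : R -> R) : decreasing_boundary c ->
  decreasing_eboundary (EFin \o c).
Proof.
move=> [cm cl]; split => // t t0 A.
exact: (cl t t0 (fun x => A x%:E)).
Qed.

Lemma increasing_eboundary_pinfty : increasing_eboundary (fun=> +oo%E : \bar R).
Proof. by split => // t t0; exact: cvg_cst. Qed.

Lemma decreasing_eboundary_ninfty : decreasing_eboundary (fun=> -oo%E : \bar R).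
Proof. by split => // t t0; exact: cvg_cst. Qed.

Lemma upper_timeE (T : Type) (X : R -> T -> R) (b : R -> R) :
  upper_time X b = two_sided_time X (EFin \o b) (fun=> -oo%E).
Proof.
congr (entry_time X); apply/funext => t; apply/seteqP; split => x /=.
  by move=> h; left; rewrite lee_fin.
by case; rewrite ?lee_fin// leNgt ltNye.
Qed.

Lemma lower_timeE (T : Type) (X : R -> T -> R) (c : R -> R) :
  lower_time X c = two_sided_time X (fun=> +oo%E) (EFin \o c).
Proof.
congr (entry_time X); apply/funext => t; apply/seteqP; split => x /=.
  by move=> h; right; rewrite lee_fin.
by case; rewrite ?lee_fin// leNgt ltey.
Qed.

End boundaries.

Lemma two_sided_unique (R : realType) (d : measure_display) (T : measurableType d)
    (P : R -> probability T R) (X : R -> T -> R)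
    (hX : diffusion P X) (hrec : recurrent P X)
    (mu : probability (measurableTypeR R) R) (hmu0 : mu [set 0] = 0%E)
    (b1 b2 c1 c2 : R -> \bar R) :
  increasing_eboundary b1 -> increasing_eboundary b2 ->
  decreasing_eboundary c1 -> decreasing_eboundary c2 ->
  embeds (P 0) X (two_sided_time X b1 c1) mu ->
  embeds (P 0) X (two_sided_time X b2 c2) mu ->
  forall t : R, 0 < t -> b1 t = b2 t /\ c1 t = c2 t.
Proof.
move=> ib1 ib2 dc1 dc2 e1 e2 t t0.
have B1 := region_barrier ib1 dc1; have B2 := region_barrier ib2 dc2.
have E := barrier_unique hX hrec hmu0 B1 B2 (@region_gap_convex _ _ _)
  (@region_gap_convex _ _ _) e1 e2 t0.
have G1 := barrier_gap hX hrec hmu0 B1 e1 t0.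
have G2 := barrier_gap hX hrec hmu0 B2 e2 t0.
have [h1 h2] := region_le E G1.
have [h3 h4] := region_le (esym E) G2.
by split; apply/eqP; rewrite eq_le ?h1 ?h2 ?h3 ?h4.
Qed.
Theorem theorem10 (R : realType) (d : measure_display) (T : measurableType d)
    (P : R -> probability T R) (X : R -> T -> R)
    (hX : diffusion P X) (hrec : recurrent P X)
    (mu : probability (measurableTypeR R) R) (hmu0 : mu [set 0] = 0%E) :
  [/\ topological_support mu `<=` [set x | 0 <= x] ->
      forall b1 b2 : R -> R,
        increasing_boundary b1 -> increasing_boundary b2 ->
        embeds (P 0) X (upper_time X b1) mu ->
        embeds (P 0) X (upper_time X b2) mu ->
        forall t : R, 0 < t -> b1 t = b2 t,
      topological_support mu `<=` [set x | x <= 0] ->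
      forall c1 c2 : R -> R,
        decreasing_boundary c1 -> decreasing_boundary c2 ->
        embeds (P 0) X (lower_time X c1) mu ->
        embeds (P 0) X (lower_time X c2) mu ->
        forall t : R, 0 < t -> c1 t = c2 t
    & topological_support mu `&` [set x | 0 <= x] !=set0 ->
      topological_support mu `&` [set x | x <= 0] !=set0 ->
      forall b1 b2 c1 c2 : R -> \bar R,
        increasing_eboundary b1 -> increasing_eboundary b2 ->
        decreasing_eboundary c1 -> decreasing_eboundary c2 ->
        embeds (P 0) X (two_sided_time X b1 c1) mu ->
        embeds (P 0) X (two_sided_time X b2 c2) mu ->
        forall t : R, 0 < t -> b1 t = b2 t /\ c1 t = c2 t].
Proof.
split => [_ b1 b2 ib1 ib2|_ c1 c2 dc1 dc2|_ _ b1 b2 c1 c2].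
- rewrite !upper_timeE => e1 e2 t t0; apply: EFin_inj.
  exact: (two_sided_unique hX hrec hmu0 (increasing_eboundary_fin ib1)
    (increasing_eboundary_fin ib2) decreasing_eboundary_ninfty
    decreasing_eboundary_ninfty e1 e2 t0).1.
- rewrite !lower_timeE => e1 e2 t t0; apply: EFin_inj.
  exact: (two_sided_unique hX hrec hmu0 increasing_eboundary_pinfty
    increasing_eboundary_pinfty (decreasing_eboundary_fin dc1)
    (decreasing_eboundary_fin dc2) e1 e2 t0).2.
- exact: two_sided_unique.
Qed.
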